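(* For each $\alpha\in[0,\infty]$ let $$S(\alpha)=\Big\{x\in[0,1] : \limsup_{N\to\infty}\frac{Nx-L(x,N)}{\sqrt{\log N}}=\frac{1}{\sqrt{2\alpha}}\ \text{and}\ \liminf_{N\to\infty}\frac{Nx-L(x,N)}{\sqrt{\log N}}=-\frac{1}{\sqrt{2\alpha}}\Big\},$$ with conventions $1/0=\infty$ and $1/\infty=0$. Then for each $\alpha\in[0,\infty]$: (i) $S(\alpha)$ is dense in $[0,1]$; (ii) for any non-empty open subset $U$ of $[0,1]$, the set $U\cap S(\alpha)$ has Hausdorff dimension $1$.
   Context: Pierce expansion digits: define $d_1\colon[0,1]\to\mathbb{N}\cup\{\infty\}$ by $d_1(x)=\lfloor 1/x\rfloor$ for $x\neq 0$ and $d_1(0)=\infty$, and $T(x)=1-d_1(x)x$ for $x\ne 0$, $T(0)=0$; put $d_k(x)=d_1(T^{k-1}(x))$. For $m,n$ positive integers let $\mathrm{mul}(m,n)=1$ if $m$ is an integer multiple of $n$ and $0$ otherwise, and let $\mathrm{mul}(m,\infty)=0$. For $x\in[0,1]$ and $N\in\mathbb{N}$, $L(x,N)$ is the number of $m\in\{1,\dots,N\}$ such that $\sum_{k\ge1}(-1)^{k+1}\mathrm{mul}(m,d_1(x)\cdots d_k(x))=1$ (the number of leap years up to year $N$ under Shallit's rule with intercalation sequence $(d_k(x))_k$; the sum runs over the $k$ with $d_k(x)<\infty$). Open subsets of $[0,1]$ are with respect to the subspace topology. *)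

(* Defs.v *)
From mathcomp Require Import all_boot all_order all_algebra.
From mathcomp Require Import all_classical all_reals all_analysis.
Import Order.TTheory GRing.Theory Num.Theory.
Import numFieldNormedType.Exports.

Set Implicit Arguments.
Unset Strict Implicit.
Unset Printing Implicit Defensive.

Local Open Scope classical_set_scope.
Local Open Scope ring_scope.

(* Coerced to a type, this carries the subspace topology inherited from R
   (subtype_topology), so [open] and [dense] are relative to [0, 1]. *)
Definition unit_interval (R : realType) : set R := `[0, 1]%classic.
Arguments unit_interval R : clear implicits.

(* Elements of {1, 2, ...} u {oo} are encoded in [option nat], oo being [None]. *)
Definition pierce_d1 (R : realType) (x : R) : option nat :=
  if x == 0 then None else Some (Num.truncn x^-1).

Definition pierce_T (R : realType) (x : R) : R :=
  if pierce_d1 x is Some d then 1 - d%:R * x else 0.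

Definition pierce_digit (R : realType) (x : R) (k : nat) : option nat :=
  pierce_d1 (iter k.-1 (@pierce_T R) x).

Definition mulo (p q : option nat) : option nat :=
  if (p, q) is (Some a, Some b) then Some (a * b)%N else None.

Definition pierce_prod (R : realType) (x : R) (k : nat) : option nat :=
  \big[mulo/Some 1%N]_(1 <= i < k.+1) pierce_digit x i.

Definition mul_ind (m : nat) (n : option nat) : nat :=
  if n is Some n' then (n' %| m)%N else 0%N.

(* A finitely supported sum for x in [0, 1] and m > 0: finite Pierce digits are
   strictly increasing, so mul_ind m (d_1 ... d_k) = 0 as soon as k > m. *)
Definition leap_sum (R : realType) (x : R) (m : nat) : int :=
  \sum_(k \in [set k | (1 <= k)%N])
    (-1) ^+ k.+1 * (mul_ind m (pierce_prod x k))%:Z.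

Definition leap_count (R : realType) (x : R) (N : nat) : nat :=
  \sum_(1 <= m < N.+1 | leap_sum x m == 1) 1.

Definition normalized_error (R : realType) (x : R) (N : nat) : \bar R :=
  ((N%:R * x - (leap_count x N)%:R) / Num.sqrt (ln N%:R))%:E.

(* In \bar R, sqrte +oo = +oo, 0^-1 = +oo and +oo^-1 = 0. *)
Definition leap_set (R : realType) (alpha : \bar R) :
    set (unit_interval R) :=
  [set x | limn_esup (normalized_error (val x)) = (1 / sqrte (2%:E * alpha))%E /\
           limn_einf (normalized_error (val x)) = (- (1 / sqrte (2%:E * alpha)))%E].

(* The maximum with 0 only matters for the empty set. *)
Definition diameter (R : realType) (A : set R) : \bar R :=
  maxe 0%E (ereal_sup [set `|x - y|%:E | x in A & y in A]).

(* |A|^s with the conventions |set0|^0 = 0 and |{a}|^0 = 1. *)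
Definition diameter_pow (R : realType) (s : R) (A : set R) : \bar R :=
  if A == set0 then 0%E else (diameter A `^ s)%E.

Definition hausdorff_premeasure (R : realType) (s delta : R) (A : set R) :
    \bar R :=
  ereal_inf [set (\sum_(0 <= i <oo) diameter_pow s (F i))%E |
    F in [set F : (set R)^nat | (forall i, (diameter (F i) <= delta%:E)%E) /\
                                A `<=` \bigcup_i F i]].

Definition hausdorff_measure (R : realType) (s : R) (A : set R) : \bar R :=
  ereal_sup [set hausdorff_premeasure s delta A | delta in [set d : R | 0 < d]].

Definition hausdorff_dim (R : realType) (A : set R) : \bar R :=
  ereal_inf [set s%:E | s in [set s : R | 0 <= s /\
                                          hausdorff_measure s A = 0%E]].

(* Main.v *)
Require Import Defs.
From mathcomp Require Import all_boot all_order all_algebra.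
From mathcomp Require Import all_classical all_reals all_analysis.
From mathcomp Require Import ring lra zify.
Import Order.TTheory GRing.Theory Num.Theory.
Import numFieldNormedType.Exports.

(* Write P_k = d_1 ... d_k. The error N x - L(x, N) is the alternating sum of the
   fractional parts of N / P_k, up to a bounded term. If P_K <= N < P_(K+1) it is
   at most K / 2 + O(1) in absolute value, while choosing the digits of N in the
   mixed radix system (d_k) alternately maximal and zero gives N < P_K with error
   at least K / 2 - O(sqrt K), of either sign. As ln P_K is the sum of the ln d_k,
   any x with ln d_k ~ alpha k lies in S(alpha).

   To get dimension 1 inside U, fix the first digits so as to stay in U and let
   each later d_k range freely over an interval ]D_k, D_(k+1)], where
   ln D_k ~ alpha k. Reading the positions of the digits in these intervals as a
   mixed radix expansion parametrizes such points by y in [0, 1), and y is an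
   s-Hoelder function of x for every s < 1, because the size of the k-th interval
   is D_(k+1)^(1-o(1)) and ln D_k is negligible against the sum of the ln D_j,
   j < k. A cover of the image thus yields a cover of [0, 1) by intervals whose
   lengths are controlled by the s-th powers of the diameters, so countable
   subadditivity of Lebesgue measure bounds the s-dimensional measure from below. *)

Local Open Scope classical_set_scope.
Local Open Scope ereal_scope.

(** * Infinite Pierce expansions with prescribed digits *)

Section Digits.
Variable R : realType.
Local Open Scope ring_scope.
Implicit Types (d : nat -> nat) (t : nat -> R).

(** Indexing starts at 0, so [d i] plays the role of $d_{i+1}$. *)
Definition digit_seq d := (0 < d 0)%N /\ forall i, (d i < d i.+1)%N.

Lemma digit_seq_shift d i : digit_seq d -> digit_seq (fun j => d (i + j)%N).
Proof.
move=> [d0 dS]; split => [|j]; last by rewrite addnS.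
by rewrite addn0; elim: i => // i IH; apply: ltn_trans (dS i).
Qed.

Lemma digit_seq_ge d i : digit_seq d -> (i < d i)%N.
Proof. by move=> [d0 dS]; elim: i => // i IH; apply: leq_ltn_trans (dS i). Qed.

Lemma digit_seq_gt0 d i : digit_seq d -> (0 < d i)%N.
Proof. by move=> /(@digit_seq_ge _ i); apply: leq_trans. Qed.

Lemma digit_seqR_gt0 d i : digit_seq d -> 0 < (d i)%:R :> R.
Proof. by rewrite ltr0n; apply: digit_seq_gt0. Qed.

(** The sequence [t] is the orbit of [t 0] under [pierce_T], characterized without floors. *)
Definition pierce_tails d t :=
  forall i, 0 <= t i <= (d i)%:R^-1 /\ t i * (d i)%:R = 1 - t i.+1.

Fixpoint pierce_convergent n d : R :=
  if n is n'.+1 then (1 - pierce_convergent n' (fun i => d i.+1)) / (d 0%N)%:R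
  else 0.

Lemma pierce_convergent_itv n d : digit_seq d ->
  0 <= pierce_convergent n d <= (d 0%N)%:R^-1.
Proof.
elim: n d => [|n IH] d dd /=; first by rewrite lexx invr_ge0 ler0n.
have /andP[h0 h1] := IH _ (digit_seq_shift d 1%N dd).
have h2 : (d 1%N)%:R^-1 <= 1 :> R.
  by rewrite invf_le1 ?digit_seqR_gt0// ler1n digit_seq_gt0.
have := le_trans h1 h2; move: h0; set p := pierce_convergent _ _ => p0 p1.
by rewrite divr_ge0 ?subr_ge0 ?ler0n//= ler_piMl ?invr_ge0 ?ler0n// gerBl.
Qed.

(** Unfolding a digit does not increase the distance, while the first digit of the shifted sequence
    is at least [d 0 + 1]. After [n] unfoldings one convergent is 0 and the other is at most the
    reciprocal of the current first digit. *)
Lemma pierce_convergent_dist n k d : digit_seq d ->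
  `|pierce_convergent n d - pierce_convergent (n + k) d| <= (d 0 + n)%N%:R^-1.
Proof.
elim: n d => [|n IH] d dd.
  have /andP[h0 h1] := pierce_convergent_itv k d dd.
  by rewrite add0n /= sub0r normrN ger0_norm// addn0.
rewrite addSn /= -mulrBl.
have -> x y : 1 - x - (1 - y) = y - x :> R by ring.
rewrite normrM normfV normr_nat.
apply: (@le_trans _ _ `|pierce_convergent n (fun i => d i.+1)
                      - pierce_convergent (n + k) (fun i => d i.+1)|).
  rewrite distrC ler_piMr// invf_le1 ?digit_seqR_gt0//.
  by rewrite ler1n digit_seq_gt0.
apply: le_trans (IH _ (digit_seq_shift d 1%N dd)) _.
have d01 := dd.2 0%N; have d0 := dd.1.
by rewrite addnS -addSn lef_pV2 ?posrE ?ltr0n ?ler_nat ?leq_add2r// addn_gt0 ?d0// (ltn_trans d0).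
Qed.

Lemma cvg_pierce_convergent d : digit_seq d ->
  cvgn (fun n => pierce_convergent n d).
Proof.
move=> dd; apply/cauchy_cvgP/cauchy_exP => _/posnumP[e].
pose N := Num.truncn e%:num^-1.
exists (pierce_convergent N d); exists N => // n /= Nn.
rewrite /ball /= -(subnKC Nn).
apply: le_lt_trans (pierce_convergent_dist N (n - N) d dd) _.
rewrite invf_plt ?posrE ?ltr0n//; last by rewrite addn_gt0 dd.1.
apply: lt_le_trans (truncnS_gt _) _; rewrite ler_nat -/N.
by have := dd.1; lia.
Qed.

Lemma exists_pierce_tails d : digit_seq d -> exists t, pierce_tails d t.
Proof.
move=> dd; have cv i := cvg_pierce_convergent _ (digit_seq_shift d i dd).
exists (fun i => limn (fun n => pierce_convergent n (fun j => d (i + j)%N))).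
move=> i; split.
  have h n := pierce_convergent_itv n _ (digit_seq_shift d i dd).
  apply/andP; split.
    by apply: limr_ge; [exact: cv | apply: nearW => n; have /andP[] := h n].
  apply: limr_le; first exact: cv.
  by apply: nearW => n; have /andP[_] := h n; rewrite addn0.
set u := limn _; set v := limn _.
have hu : pierce_convergent n.+1 (fun j => d (i + j)%N) @[n --> \oo] --> u.
  by rewrite (cvg_shiftS (fun n => pierce_convergent n (fun j => d (i + j)%N))); exact: cv.
have hv : (1 - pierce_convergent n (fun j => d (i.+1 + j)%N)) / (d i)%:R
    @[n --> \oo] --> (1 - v) / (d i)%:R.
  by apply: cvgMl; apply: cvgB; [exact: cvg_cst | exact: cv].
have -> : u = (1 - v) / (d i)%:R.
  apply: cvg_unique hu _ => //.
  have -> : (fun n => pierce_convergent n.+1 (fun j => d (i + j)%N)) =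
     (fun n => (1 - pierce_convergent n (fun j => d (i.+1 + j)%N)) / (d i)%:R).
    apply/funext => n /=; rewrite addn0; congr ((1 - pierce_convergent n _) / _).
    by apply/funext => j; rewrite addnS addSn.
  exact: hv.
by rewrite divfK// gt_eqF ?digit_seqR_gt0.
Qed.

Lemma pierce_tails_gt0 d t i : digit_seq d -> pierce_tails d t -> 0 < t i.
Proof.
move=> dd dt; have [/andP[h0 _] e1] := dt i; have [/andP[_ h1] e2] := dt i.+1.
rewrite lt_neqAle h0 andbT eq_sym; apply/eqP => ti0.
move: e1; rewrite ti0 mul0r => /eqP; rewrite eq_sym subr_eq0 => /eqP t1.
have d1 : 1 < (d i.+1)%:R :> R.
  by rewrite ltr1n; have := dd.2 i; have := digit_seq_gt0 d i dd; lia.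
by move: h1; rewrite -t1 leNgt invf_lt1 ?d1// digit_seqR_gt0.
Qed.

Lemma pierce_d1_tails d t i : digit_seq d -> pierce_tails d t ->
  pierce_d1 (t i) = Some (d i).
Proof.
move=> dd dt; have ti := pierce_tails_gt0 d t i dd dt.
rewrite /pierce_d1 gt_eqF//; congr Some; apply: truncn_def.
have [/andP[h0 h1] e1] := dt i; have [/andP[_ h2] e2] := dt i.+1.
have dp := digit_seqR_gt0 d i dd.
rewrite -(invrK (d i)%:R) lef_pV2 ?posrE ?invr_gt0// h1 /= invf_plt ?posrE ?ltr0Sn//.
(* Strictness matters: [t i.+2 > 0] gives [t i.+1 < 1 / (d i + 1)], hence [t i > 1 / (d i + 1)],
   which pins down the floor. *)
have t2 := pierce_tails_gt0 d t i.+2 dd dt.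
have h3 : t i.+1 < (d i).+1%:R^-1.
  have dS : (d i).+1%:R <= (d i.+1)%:R :> R by rewrite ler_nat; exact: dd.2.
  rewrite -(ltr_pM2r (digit_seqR_gt0 d i.+1 dd)) e2.
  rewrite (@lt_le_trans _ _ 1)// ?gtrBl// mulrC ler_pdivlMr ?ltr0Sn// mul1r//.
rewrite -(ltr_pM2r dp) e1.
have : (d i).+1%:R^-1 * (d i)%:R = 1 - (d i).+1%:R^-1 :> R.
  by rewrite -[in LHS](addrK 1 (d i)%:R) natr1 mulrBr mulVf ?mulr1// pnatr_eq0.
by move=> ->; rewrite ltrD2l ltrN2.
Qed.

Lemma iter_pierce_T d t i : digit_seq d -> pierce_tails d t ->
  iter i (@pierce_T R) (t 0%N) = t i.
Proof.
move=> dd dt; elim: i => // i IH.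
rewrite iterS IH /pierce_T (pierce_d1_tails d t)//.
by rewrite mulrC (dt i).2 opprB addrC subrK.
Qed.

Lemma pierce_digit_tails d t k : digit_seq d -> pierce_tails d t ->
  pierce_digit (t 0%N) k.+1 = Some (d k).
Proof.
by move=> dd dt; rewrite /pierce_digit /= (iter_pierce_T d t)// (pierce_d1_tails d t).
Qed.

Definition digit_prod d k := (\prod_(i < k) d i)%N.

Lemma digit_prodS d k : digit_prod d k.+1 = (digit_prod d k * d k)%N.
Proof. by rewrite /digit_prod big_ord_recr. Qed.

Lemma digit_prod_gt0 d k : digit_seq d -> (0 < digit_prod d k)%N.
Proof. by move=> dd; rewrite prodn_gt0// => i; exact: digit_seq_gt0. Qed.

Lemma digit_prod_ge d k : digit_seq d -> (k <= digit_prod d k)%N.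
Proof.
move=> dd; case: k => // k; rewrite digit_prodS.
by have := digit_prod_gt0 d k dd; have := digit_seq_ge d k dd; nia.
Qed.

Lemma pierce_prod_tails d t k : digit_seq d -> pierce_tails d t ->
  pierce_prod (t 0%N) k = Some (digit_prod d k).
Proof.
move=> dd dt; rewrite /pierce_prod big_add1 /=.
have hM n m : Some (n * m)%N = Defs.mulo (Some n) (Some m) by [].
rewrite /digit_prod -(big_mkord xpredT d).
rewrite (big_morph (@Some nat) hM (erefl (Some 1%N))).
by apply: eq_bigr => i _; apply: pierce_digit_tails.
Qed.

(** The remainder is kept exact, so no infinite series occurs; multiplied by [N], it becomes the
    bounded last term of the leap year error. *)
Lemma pierce_expansion d t K : digit_seq d -> pierce_tails d t ->
  t 0%N = \sum_(k < K) (-1) ^+ k / (digit_prod d k.+1)%:R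
          + (-1) ^+ K * t K / (digit_prod d K)%:R.
Proof.
move=> dd dt; elim: K => [|K {1}->].
  by rewrite big_ord0 expr0 /digit_prod big_ord0 mul1r divr1 add0r.
rewrite big_ord_recr /= -!addrA; congr (_ + _).
have dK : (d K)%:R != 0 :> R by rewrite gt_eqF ?digit_seqR_gt0.
have PK : (digit_prod d K)%:R != 0 :> R by rewrite pnatr_eq0 -lt0n digit_prod_gt0.
have -> : t K = (1 - t K.+1) / (d K)%:R by rewrite -(dt K).2 mulfK.
rewrite digit_prodS natrM exprS; field; exact/andP.
Qed.

Lemma pierce_prefix_sub d d' t t' k : digit_seq d -> digit_seq d' ->
  pierce_tails d t -> pierce_tails d' t' ->
  (forall i, (i < k)%N -> d i = d' i) ->
  `|t 0%N - t' 0%N| = `|t k - t' k| / (digit_prod d k)%:R.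
Proof.
move=> dd dd' dt dt' e.
have eP j : (j <= k)%N -> digit_prod d j = digit_prod d' j.
  by move=> jk; apply: eq_bigr => i _; rewrite e// (leq_trans (ltn_ord i)).
rewrite (pierce_expansion d t k)// (pierce_expansion d' t' k)//.
have -> : \sum_(i < k) (-1) ^+ i / (digit_prod d i.+1)%:R =
          \sum_(i < k) (-1) ^+ i / (digit_prod d' i.+1)%:R :> R.
  by apply: eq_bigr => i _; rewrite eP.
rewrite opprD addrACA subrr add0r eP// -mulrBl -mulrBr normrM normrM normrX.
by rewrite normrN1 expr1n mul1r normfV normr_nat.
Qed.

End Digits.

(** * The leap year error as an alternating sum of fractional parts *)

Section LeapCount.
Variable R : realType.
Local Open Scope ring_scope.
Implicit Types (d : nat -> nat) (t : nat -> R).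

Lemma digit_prod_dvd d i k : (i <= k)%N -> (digit_prod d i %| digit_prod d k)%N.
Proof.
move=> /subnKC <-; elim: (k - i)%N => [|j IH]; first by rewrite addn0.
by rewrite addnS digit_prodS dvdn_mulr.
Qed.

(** Each product divides the next, so none from [digit_prod d K] on can divide a smaller positive
    [m]. *)
Lemma leap_sum_tails d t m K : digit_seq d -> pierce_tails R d t ->
  (0 < m < digit_prod d K)%N ->
  leap_sum (t 0%N) m = \sum_(k < K) (-1) ^+ k * (digit_prod d k.+1 %| m)%N%:Z.
Proof.
move=> dd dt /andP[m0 mK]; rewrite /leap_sum.
under eq_fsbigr do rewrite (pierce_prod_tails R d t)//=.
transitivity (\sum_(k \in [set` index_iota 1 K.+1])
    (-1) ^+ k.+1 * (digit_prod d k %| m)%N%:Z : int).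
  symmetry; apply: fsbig_widen => k /=.
    by rewrite mem_index_iota => /andP[].
  move=> [k1]; rewrite mem_index_iota => /negP; rewrite k1 /= ltnS -ltnNge => Kk.
  have /negbTE -> : ~~ (digit_prod d k %| m)%N; last by rewrite mulr0.
  apply/negP => /(dvdn_leq m0); rewrite leqNgt (leq_trans mK)//.
  by rewrite dvdn_leq ?digit_prod_gt0// digit_prod_dvd// ltnW.
rewrite -fsbig_seq ?iota_uniq// big_add1 /= big_mkord.
by apply: eq_bigr => k _; rewrite !exprS !mulN1r !mulNr opprK.
Qed.

(** The indicators are 1 up to some index and 0 afterwards, so their alternating sum is 0 or 1. When
    leap years are counted, the test [leap_sum x m == 1] can thus be replaced by the value of
    [leap_sum x m]. *)
Lemma alternating_indicator_sum (a : nat -> bool) K :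
  (forall k, a k.+1 -> a k) ->
  \sum_(k < K) (-1) ^+ k * (a k)%:Z = 0 \/
  a 0%N /\ \sum_(k < K) (-1) ^+ k * (a k)%:Z = 1.
Proof.
elim: K a => [|K IH] a ha; first by left; rewrite big_ord0.
rewrite big_ord_recl /= expr0 mul1r.
have -> : \sum_(i < K) (-1) ^+ bump 0 i * (a (bump 0 i))%:Z
        = - \sum_(i < K) (-1) ^+ i * (a i.+1)%:Z :> int.
  by rewrite -sumrN; apply: eq_bigr => i _; rewrite /bump /= exprS mulN1r mulNr.
case: (IH (fun k => a k.+1)) => [k|->|[/ha a0 ->]]; first exact: ha.
- by case: (a 0%N); [right | left]; rewrite subr0.
- by left; rewrite a0 subrr.
Qed.

Lemma leap_count_tails d t N K : digit_seq d -> pierce_tails R d t ->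
  (N < digit_prod d K)%N ->
  (leap_count (t 0%N) N)%:R =
    \sum_(k < K) (-1) ^+ k * (N %/ digit_prod d k.+1)%N%:R :> R.
Proof.
move=> dd dt NK.
have e : (leap_count (t 0%N) N)%:Z =
    \sum_(1 <= m < N.+1) \sum_(k < K) (-1) ^+ k * (digit_prod d k.+1 %| m)%N%:Z.
  rewrite /leap_count big_mkcond /= -[LHS]natz natr_sum big_nat [RHS]big_nat.
  apply: eq_bigr => m /andP[m0 mN].
  have mK : (0 < m < digit_prod d K)%N by rewrite m0 (leq_ltn_trans _ NK).
  rewrite (leap_sum_tails d t m K dd dt mK).
  have ha k : (digit_prod d k.+2 %| m)%N -> (digit_prod d k.+1 %| m)%N.
    by apply: dvdn_trans; exact: digit_prod_dvd.
  by case: (alternating_indicator_sum _ K ha) => [->|[_ ->]].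
transitivity (((leap_count (t 0%N) N)%:Z)%:~R : R); first by rewrite pmulrn.
rewrite e exchange_big /= raddf_sum /=; apply: eq_bigr => k _.
rewrite -mulr_sumr intrM rmorphXn rmorphN1; congr (_ * _).
by rewrite divn_count_dvd natr_sum raddf_sum.
Qed.

Lemma leap_error_expansion d t N K : digit_seq d -> pierce_tails R d t ->
  (N < digit_prod d K)%N ->
  N%:R * t 0%N - (leap_count (t 0%N) N)%:R =
  \sum_(k < K) (-1) ^+ k * ((N %% digit_prod d k.+1)%N%:R / (digit_prod d k.+1)%:R)
  + (-1) ^+ K * (N%:R / (digit_prod d K)%:R * t K).
Proof.
move=> dd dt NK; rewrite (leap_count_tails d t N K)// {1}(pierce_expansion _ d t K)//.
rewrite mulrDr mulr_sumr addrAC -sumrB; congr (_ + _); last by ring.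
apply: eq_bigr => k _.
have P0 : (digit_prod d k.+1)%:R != 0 :> R by rewrite pnatr_eq0 -lt0n digit_prod_gt0.
by rewrite {1}(divn_eq N (digit_prod d k.+1)) natrD natrM; field.
Qed.

Lemma pierce_tails_le1 d t i : digit_seq d -> pierce_tails R d t -> 0 <= t i <= 1.
Proof.
move=> dd dt; have [/andP[-> h] _] := dt i; apply: le_trans h _.
by rewrite invf_le1 ?digit_seqR_gt0// ler1n digit_seq_gt0.
Qed.

Lemma digit_frac_itv d N k : digit_seq d ->
  0 <= ((N %% digit_prod d k)%N%:R : R) / (digit_prod d k)%:R <= 1.
Proof.
move=> dd; have P0 := digit_prod_gt0 d k dd.
rewrite divr_ge0 ?ler0n//= ler_pdivrMr ?ltr0n// mul1r ler_nat ltnW//.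
exact: ltn_pmod.
Qed.

Lemma leap_remainder_itv d t N K : digit_seq d -> pierce_tails R d t ->
  (N < digit_prod d K)%N -> 0 <= N%:R / (digit_prod d K)%:R * t K <= 1.
Proof.
move=> dd dt NK; have /andP[h0 h1] := pierce_tails_le1 d t K dd dt.
have P0 := digit_prod_gt0 d K dd.
rewrite mulr_ge0 ?divr_ge0 ?ler0n//= mulr_ile1 ?divr_ge0 ?ler0n//.
by rewrite ler_pdivrMr ?ltr0n// mul1r ler_nat ltnW.
Qed.

(** Below [K] there are [(K + odd K) / 2] even and [(K - odd K) / 2] odd indices; each bound drops
    the terms of the opposite sign. *)
Lemma alternating_sum_itv (f : nat -> R) K : (forall k, 0 <= f k <= 1) ->
  - ((K - odd K)%N%:R / 2) <= \sum_(k < K) (-1) ^+ k * f k <= (K + odd K)%N%:R / 2.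
Proof.
move=> f01; elim: K => [|K IH]; first by rewrite big_ord0 mul0r oppr0 lexx.
have /andP[h0 h1] := f01 K.
rewrite big_ord_recr /= -signr_odd.
case: (boolP (odd K)) IH => oK /andP[l u] /=; rewrite ?expr1 ?expr0.
- have e : K.+1%:R = (K - 1)%N%:R + 2 :> R.
    by rewrite -natrD; congr (_%:R); case: (K) oK => // k _; lia.
  have e' : (K + 1)%N%:R = (K - 1)%N%:R + 2 :> R by rewrite addn1.
  move: l u; rewrite subn0 addn0 e e' /= => l u.
  by apply/andP; split; lra.
- move: l u; rewrite subn0 addn0 subn1 addn1 /= => l u.
  rewrite -[K.+2]addn2 natrD.
  by apply/andP; split; lra.
Qed.

(** The [K + 1] fractional parts contribute at most [(K + 2) / 2] in absolute value, and the
    remainder at most 1. *)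
Lemma leap_error_le d t N K : digit_seq d -> pierce_tails R d t ->
  (N < digit_prod d K.+1)%N ->
  `|N%:R * t 0%N - (leap_count (t 0%N) N)%:R| <= K%:R / 2 + 2.
Proof.
move=> dd dt NK; rewrite (leap_error_expansion d t N K.+1)//.
have /andP[r0 r1] := leap_remainder_itv d t N K.+1 dd dt NK.
have h : forall k, 0 <= ((N %% digit_prod d k.+1)%N%:R : R) / (digit_prod d k.+1)%:R <= 1.
  by move=> k; exact: digit_frac_itv.
have := alternating_sum_itv _ K.+1 h.
set S := \sum_(k < _) _; set r := _ / _ * _ in r0 r1 *.
move=> /andP[l u].
have u1 : S <= (K%:R + 2) / 2.
  by apply: le_trans u _; rewrite ler_pM2r ?invr_gt0// -natrD ler_nat; case: (odd _); lia.
have l1 : - ((K%:R + 2) / 2) <= S.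
  apply: le_trans l; rewrite lerN2 ler_pM2r ?invr_gt0// -natrD ler_nat; lia.
rewrite -signr_odd; case: (odd _); rewrite ?expr1 ?expr0 ler_norml.
  by apply/andP; split; lra.
by apply/andP; split; lra.
Qed.

(* In the mixed radix system of the digits, the digit of weight [digit_prod d k]
   is maximal when [odd k == e] and 0 otherwise, so that the fractional parts of
   [N / digit_prod d k.+1] are alternately close to 1 and to 0. *)
Fixpoint extremal_year d (e : bool) K : nat :=
  if K is K'.+1 then
    (extremal_year d e K' + (odd K' == e) * ((d K').-1 * digit_prod d K'))%N
  else 0%N.

Lemma extremal_year_lt d e K : digit_seq d ->
  (extremal_year d e K < digit_prod d K)%N.
Proof.
move=> dd; elim: K => [|K IH]; first by rewrite /digit_prod big_ord0.
rewrite /= digit_prodS; have := digit_seq_gt0 d K dd.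
by case: (_ == _); rewrite ?mul1n ?mul0n; nia.
Qed.

Lemma extremal_year_mod d e K k : digit_seq d -> (k <= K)%N ->
  (extremal_year d e K %% digit_prod d k)%N = extremal_year d e k.
Proof.
move=> dd /subnKC <-; elim: (K - k)%N => [|j IH].
  by rewrite addn0 modn_small// extremal_year_lt.
rewrite addnS /= -modnDmr.
have /eqP -> : (digit_prod d k %|
    (odd (k + j) == e) * ((d (k + j)).-1 * digit_prod d (k + j)))%N.
  by rewrite 2?dvdn_mull// digit_prod_dvd// leq_addr.
by rewrite addn0 IH.
Qed.

(** One of the two top positions has parity [e], and its maximal digit is at least [K]. Extremal
    years are therefore arbitrarily large. *)
Lemma extremal_year_ge d e K : digit_seq d -> (K <= extremal_year d e K.+2)%N.
Proof.
move=> dd /=.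
have := digit_seq_ge d K dd; have := digit_seq_ge d K.+1 dd.
have := digit_prod_gt0 d K dd; have := digit_prod_gt0 d K.+1 dd.
by case: e; case: (odd K) => /=; nia.
Qed.

(** If the parity matches, the leading digit [d k - 1] puts the fractional part within [1 / d k] of
    1; otherwise the leading digit is 0 and the fractional part is at most [1 / d k]. *)
Lemma extremal_year_frac d e k : digit_seq d ->
  (odd k == e)%:R - (d k)%:R^-1 <=
  (-1) ^+ e * ((-1) ^+ k * ((extremal_year d e k.+1)%:R / (digit_prod d k.+1)%:R)) :> R.
Proof.
move=> dd; have dk := digit_seqR_gt0 R d k dd.
have P0 : 0 < (digit_prod d k)%:R :> R by rewrite ltr0n digit_prod_gt0.
have yk : 0 <= ((extremal_year d e k)%:R : R) <= (digit_prod d k)%:R.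
  by rewrite ler0n ler_nat ltnW// extremal_year_lt.
have P1 : 0 < (digit_prod d k.+1)%:R :> R by rewrite ltr0n digit_prod_gt0.
rewrite /= mulrA -(signr_odd _ k); case: eqP => [<-|/eqP ne] /=.
  rewrite -expr2 sqrr_sign !mul1r mul1n ler_pdivlMr// digit_prodS natrD !natrM.
  have -> : ((d k).-1)%:R = (d k)%:R - 1 :> R.
    by rewrite -subn1 natrB// digit_seq_gt0.
  have -> : (1 - (d k)%:R^-1) * ((digit_prod d k)%:R * (d k)%:R) =
            ((d k)%:R - 1) * (digit_prod d k)%:R :> R by field; lra.
  by rewrite lerDr; case/andP: yk.
rewrite mul0n addn0 sub0r -signr_addb.
have -> : e (+) odd k by move: ne; clear; case: e; case: (odd k).
rewrite expr1 mulN1r lerN2 digit_prodS natrM invfM mulrA ler_piMl ?invr_ge0 ?ler0n//.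
by rewrite ler_pdivrMr// mul1r; case/andP: yk.
Qed.

Lemma sum_parity e K : (K <= 2 * (\sum_(k < K) (odd k == e)) + 1)%N.
Proof.
suff h : (K <= 2 * (\sum_(k < K) (odd k == e)) + (odd K == e))%N.
  by apply: leq_trans h _; rewrite leq_add2l leq_b1.
elim: K => // K IH; rewrite big_ord_recr /=.
by move: IH; case: (odd K); case: e => /=; lia.
Qed.

(** Of the constant [3 / 2], a half is lost in counting the indices of parity [e], and 1 on the
    remainder. *)
Lemma extremal_year_error d t e K : digit_seq d -> pierce_tails R d t ->
  forall N, N = extremal_year d e K ->
  K%:R / 2 - \sum_(k < K) (d k)%:R^-1 - 3 / 2 <=
  (-1) ^+ e * (N%:R * t 0%N - (leap_count (t 0%N) N)%:R).
Proof.
move=> dd dt N eN; have NK : (N < digit_prod d K)%N by rewrite eN extremal_year_lt.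
rewrite (leap_error_expansion d t N K)//.
have := leap_remainder_itv d t N K dd dt NK; set r := _ / _ * _ => r01.
have hr : -1 <= (-1) ^+ e * ((-1) ^+ K * r).
  rewrite mulrA -(signr_odd _ K) -signr_addb.
  by case: (_ (+) _); rewrite ?expr1 ?expr0; case/andP: r01 => *; lra.
rewrite mulrDr mulr_sumr.
have hs : \sum_(k < K) ((odd k == e)%:R - (d k)%:R^-1) <=
    \sum_(k < K) (-1) ^+ e *
      ((-1) ^+ k * ((N %% digit_prod d k.+1)%N%:R / (digit_prod d k.+1)%:R)) :> R.
  by apply: ler_sum => k _; rewrite eN extremal_year_mod// extremal_year_frac.
rewrite sumrB in hs.
have hp : K%:R <= 2 * \sum_(k < K) (odd k == e)%:R + 1 :> R.
  by rewrite -natr_sum -natrM natr1 -addn1 ler_nat; exact: sum_parity.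
lra.
Qed.

End LeapCount.

(** * From the growth of the digits to the limsup and liminf *)

Section LimsupError.
Variable R : realType.
Local Open Scope ring_scope.
Implicit Types (d : nat -> nat) (t : nat -> R) (alpha : \bar R).

Lemma lte_dense_real (x y : \bar R) : (x < y)%E -> exists a : R, (x < a%:E < y)%E.
Proof.
case: x y => [x||] [y||]//=; rewrite ?lte_fin => xy.
- by exists ((x + y) / 2); rewrite !lte_fin !midf_lt.
- by exists (x + 1); rewrite lte_fin ltrDl ltr01 ltry.
- by exists (y - 1); rewrite lte_fin gtrBl ltr01 ltNyr.
- by exists 0; rewrite ltNyr ltry.
Qed.

(** The thresholds are real even for infinite [rho], in which case one of the two conditions is
    vacuous. *)
Lemma limn_esup_eq (u : (\bar R)^nat) (rho : \bar R) :
  (forall a : R, (rho < a%:E)%E ->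
    exists M, forall N, (M <= N)%N -> (u N <= a%:E)%E) ->
  (forall (a : R) M, (a%:E < rho)%E ->
    exists2 N, (M <= N)%N & (a%:E <= u N)%E) ->
  limn_esup u = rho.
Proof.
move=> hu hl; apply/eqP; rewrite eq_le; apply/andP; split.
  rewrite leNgt; apply/negP => /lte_dense_real [a /andP[ra au]].
  have [M hM] := hu _ ra.
  move: au; apply/negP; rewrite -leNgt.
  apply: (@le_trans _ _ (ereal_sup (u @` [set N | (M <= N)%N]))).
    by apply: ereal_inf_lbound; exists [set N | (M <= N)%N] => //; exists M.
  by apply: ge_ereal_sup => _ [N /= MN <-]; exact: hM.
apply: le_ereal_inf_tmp => _ [V [M _ MV] <-].
rewrite leNgt; apply/negP => /lte_dense_real [a /andP[sa ar]].
have [N MN aN] := hl _ M ar.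
move: sa; apply/negP; rewrite -leNgt; apply: le_trans aN _.
by apply: ereal_sup_ubound; exists N => //; exact: MV.
Qed.

Definition leap_rate alpha : \bar R := (1 / sqrte (2%:E * alpha))%E.

Lemma leap_rate_fin (r : R) : 0 < r -> leap_rate r%:E = (1 / Num.sqrt (2 * r))%:E.
Proof.
move=> r0; have s0 : Num.sqrt (2 * r) != 0 by rewrite gt_eqF// sqrtr_gt0 mulr_gt0.
by rewrite /leap_rate -EFinM /= inver (negPf s0) -EFinM.
Qed.

Lemma leap_rate0 : leap_rate 0 = +oo%E.
Proof. by rewrite /leap_rate mule0 sqrte0 inve0 mul1e. Qed.

Lemma leap_ratey : leap_rate +oo = 0%E.
Proof. by rewrite /leap_rate gt0_muley ?lte_fin//= invey mule0. Qed.

Lemma leap_rate_ge0 alpha : (0 <= alpha)%E -> (0 <= leap_rate alpha)%E.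
Proof.
case: alpha => [r||//]; last by rewrite leap_ratey.
rewrite lee_fin le_eqVlt => /predU1P[<-|r0]; first by rewrite leap_rate0.
by rewrite leap_rate_fin// lee_fin divr_ge0// sqrtr_ge0.
Qed.

(** Since [a > 1 / sqrt (2 alpha)] means [1 / (2 a^2) < alpha], any [b] strictly between these two
    works: the midpoint, or [1 / a^2] when [alpha] is infinite. *)
Lemma leap_rate_lt alpha (a : R) : (0 <= alpha)%E -> (leap_rate alpha < a%:E)%E ->
  0 < a /\ exists2 b : R, (0 < b /\ 1 < 2 * b * a ^+ 2) & (b%:E < alpha)%E.
Proof.
move=> al0 ha; have a0 : 0 < a.
  by rewrite -lte_fin; apply: le_lt_trans ha; exact: leap_rate_ge0.
split=> //; have a20 : 0 < a ^+ 2 by rewrite exprn_gt0.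
case: alpha al0 ha => [r|_ _|//].
  rewrite lee_fin le_eqVlt => /predU1P[<-|r0]; first by rewrite leap_rate0.
  rewrite leap_rate_fin// lte_fin ltr_pdivrMr ?sqrtr_gt0 ?mulr_gt0// => h.
  have h2 : 1 < a ^+ 2 * (2 * r).
    by rewrite -(sqr_sqrtr (_ : 0 <= 2 * r)) ?mulr_ge0 ?(ltW r0)// -exprMn exprn_egt1.
  exists ((r + (2 * a ^+ 2)^-1) / 2).
    split; first by rewrite divr_gt0// addr_gt0// invr_gt0 mulr_gt0.
    have -> : 2 * ((r + (2 * a ^+ 2)^-1) / 2) * a ^+ 2 = a ^+ 2 * r + 2^-1.
      by field; rewrite gt_eqF.
    lra.
  have : (2 * a ^+ 2)^-1 < r by rewrite -[_^-1]mul1r ltr_pdivrMr ?mulr_gt0//; lra.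
  by rewrite lte_fin; lra.
exists (a ^+ 2)^-1; last by rewrite ltry.
by rewrite invr_gt0; split=> //; rewrite mulfVK ?gt_eqF// ltr1n.
Qed.

Lemma lt_leap_rate alpha (a : R) : (0 <= alpha)%E -> 0 < a ->
  (a%:E < leap_rate alpha)%E ->
  exists2 b : R, (0 < b /\ 2 * b * a ^+ 2 < 1) & (alpha < b%:E)%E.
Proof.
move=> al0 a0; have a20 : 0 < a ^+ 2 by rewrite exprn_gt0.
case: alpha al0 => [r|_|//]; last by rewrite leap_ratey lte_fin ltNge ltW.
rewrite lee_fin le_eqVlt => /predU1P[<- _|r0].
  exists (4 * a ^+ 2)^-1; last by rewrite lte_fin invr_gt0 mulr_gt0.
  split; first by rewrite invr_gt0 mulr_gt0.
  have -> : 2 * (4 * a ^+ 2)^-1 * a ^+ 2 = 2^-1 by field; rewrite gt_eqF.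
  lra.
rewrite leap_rate_fin// lte_fin ltr_pdivlMr ?sqrtr_gt0 ?mulr_gt0// => h.
have h2 : a ^+ 2 * (2 * r) < 1.
  rewrite -(sqr_sqrtr (_ : 0 <= 2 * r)) ?mulr_ge0 ?(ltW r0)// -exprMn.
  by rewrite exprn_ilt1// mulr_ge0 ?(ltW a0) ?sqrtr_ge0.
have h3 : r < (2 * a ^+ 2)^-1.
  by rewrite -(mulr1 (_^-1)) mulrC ltr_pdivlMr ?mulr_gt0//; lra.
exists ((r + (2 * a ^+ 2)^-1) / 2).
  split; first by rewrite divr_gt0// addr_gt0// invr_gt0 mulr_gt0.
  have -> : 2 * ((r + (2 * a ^+ 2)^-1) / 2) * a ^+ 2 = a ^+ 2 * r + 2^-1.
    by field; rewrite gt_eqF.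
  lra.
by rewrite lte_fin; lra.
Qed.

Definition log_digit_sum d K : R := \sum_(i < K) ln (d i)%:R.

Lemma ln_prodn (f : nat -> nat) K : (forall i, (0 < f i)%N) ->
  ln (\prod_(i < K) f i)%N%:R = \sum_(i < K) ln (f i)%:R :> R.
Proof.
move=> f0; elim: K => [|K IH]; first by rewrite !big_ord0 ln1.
rewrite !big_ord_recr natrM lnM ?posrE ?ltr0n ?f0 ?IH//.
by apply: prodn_gt0 => i; exact: f0.
Qed.

Lemma ln_digit_prod d K : digit_seq d -> ln (digit_prod d K)%:R = log_digit_sum d K.
Proof. by move=> dd; apply: ln_prodn => i; exact: digit_seq_gt0. Qed.

(** As [d k >= k + 1], each term is at most the telescoping difference [2 (sqrt (k + 1) - sqrt k)].
    The resulting bound is negligible against [K / 2]. *)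
Lemma sum_inv_digits d K : digit_seq d ->
  \sum_(k < K) (d k)%:R^-1 <= 2 * Num.sqrt K%:R :> R.
Proof.
move=> dd; elim: K => [|K IH]; first by rewrite big_ord0 sqrtr0 mulr0.
rewrite big_ord_recr /=.
have h : (d K)%:R^-1 <= K.+1%:R^-1 :> R.
  by rewrite lef_pV2 ?posrE ?digit_seqR_gt0// ler_nat; exact: digit_seq_ge.
have : K.+1%:R^-1 <= 2 * (Num.sqrt K.+1%:R - Num.sqrt K%:R) :> R.
  set x := Num.sqrt K.+1%:R; set y := Num.sqrt K%:R.
  have x2 : x ^+ 2 = K.+1%:R by rewrite sqr_sqrtr.
  have y2 : y ^+ 2 = K%:R by rewrite sqr_sqrtr.
  have xy : x ^+ 2 - y ^+ 2 = 1 by rewrite x2 y2 -natrB// subSnn.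
  have y0 : 0 <= y by exact: sqrtr_ge0.
  have x1 : 1 <= x by rewrite -sqrtr1 ler_wsqrtr// ler1n.
  have yx : y <= x by rewrite ler_wsqrtr// ler_nat.
  rewrite -x2 -[_^-1]mul1r ler_pdivrMr ?exprn_gt0 ?(lt_le_trans _ x1)//.
  have h1 : 1 <= 2 * (x - y) * x by nra.
  have h0 : 0 <= 2 * (x - y) * x by lra.
  by apply: le_trans h1 _; rewrite expr2 [leRHS]mulrA ler_peMr.
move=> h2; rewrite [leRHS](_ : _ = 2 * Num.sqrt K%:R +
    2 * (Num.sqrt K.+1%:R - Num.sqrt K%:R)); last by rewrite -mulrDr addrC subrK.
by apply: lerD IH (le_trans h h2).
Qed.

Lemma digit_prod_bracket d K0 N : digit_seq d -> (digit_prod d K0 <= N)%N ->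
  exists2 K, (K0 <= K)%N & (digit_prod d K <= N < digit_prod d K.+1)%N.
Proof.
move=> dd K0N.
have ex : exists K, (N < digit_prod d K)%N.
  by exists N.+1; exact: digit_prod_ge.
case: (ex_minnP ex) => -[|K] NK minK.
  by move: NK; rewrite /digit_prod big_ord0; have := digit_prod_gt0 d K0 dd; lia.
exists K; last by rewrite NK andbT leqNgt; apply/negP => /minK; rewrite ltnn.
rewrite leqNgt; apply/negP => KK0; move: NK; rewrite ltnNge => /negP; apply.
by apply: leq_trans K0N; rewrite dvdn_leq ?digit_prod_gt0// digit_prod_dvd.
Qed.

Lemma archi_nat (x : R) : exists K0, forall K, (K0 <= K)%N -> x <= K%:R.
Proof.
exists (Num.truncn x).+1 => K hK; apply: ltW; apply: lt_le_trans (truncnS_gt x) _.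
by rewrite ler_nat.
Qed.

(** This encodes [ln P_K ~ alpha K^2 / 2] by one-sided bounds, which also make sense for [alpha = 0]
    and [alpha = +oo]. *)
Definition log_digits_rate d alpha :=
  (forall b : R, 0 < b -> (b%:E < alpha)%E ->
    exists K0, forall K, (K0 <= K)%N -> b * K%:R ^+ 2 / 2 <= log_digit_sum d K) /\
  (forall b : R, (alpha < b%:E)%E ->
    exists K0, forall K, (K0 <= K)%N -> log_digit_sum d K <= b * K%:R ^+ 2 / 2).

Lemma leap_error_eventually_le d t alpha (a : R) : digit_seq d -> pierce_tails R d t ->
  (0 <= alpha)%E -> log_digits_rate d alpha -> (leap_rate alpha < a%:E)%E ->
  exists M, forall N, (M <= N)%N ->
    `|(N%:R * t 0%N - (leap_count (t 0%N) N)%:R) / Num.sqrt (ln N%:R)| <= a.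
Proof.
move=> dd dt al0 [hlo _] /(leap_rate_lt _ _ al0)[a0 [b [b0 hb] bal]].
have [K0 hK0] := hlo b b0 bal.
(* As [sqrt (ln N) >= sqrt (b / 2) K], it suffices that [K / 2 + 2 <= c K]. The choice of [b] makes
   [c > 1 / 2], so this holds once [K >= 2 / (c - 1 / 2)]. *)
pose c := a * Num.sqrt (b / 2).
have c0 : 0 <= c by rewrite mulr_ge0 ?(ltW a0) ?sqrtr_ge0.
have c2 : 2^-1 < c.
  have : c ^+ 2 = a ^+ 2 * (b / 2) by rewrite exprMn sqr_sqrtr ?divr_ge0 ?(ltW b0).
  by nra.
have [K1 hK1] := archi_nat (2 / (c - 2^-1)).
exists (digit_prod d (maxn 1 (maxn K0 K1))) => N /(digit_prod_bracket _ _ _ dd)[K].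
rewrite !geq_max => /and3P[K10 KK0 KK1] /andP[PN NP].
have lnN : b * K%:R ^+ 2 / 2 <= ln N%:R.
  apply: le_trans (hK0 K KK0) _; rewrite -ln_digit_prod// ler_ln ?posrE ?ltr0n ?digit_prod_gt0//.
    by rewrite ler_nat.
  by apply: leq_trans PN; exact: digit_prod_gt0.
have lnN0 : 0 < ln N%:R :> R.
  by apply: lt_le_trans lnN; rewrite divr_gt0// mulr_gt0// exprn_gt0// ltr0n.
have cK : c * K%:R <= a * Num.sqrt (ln N%:R).
  rewrite -mulrA ler_pM2l//; apply: le_trans (ler_wsqrtr lnN).
  have -> : b * K%:R ^+ 2 / 2 = b / 2 * K%:R ^+ 2 by ring.
  by rewrite [Num.sqrt (_ * _ ^+ 2)]sqrtrM ?divr_ge0 ?(ltW b0)// sqrtr_sqr ger0_norm.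
rewrite normrM normfV [X in _ / X]ger0_norm ?sqrtr_ge0// ler_pdivrMr ?sqrtr_gt0//.
apply: le_trans (leap_error_le R d t N K dd dt NP) _; apply: le_trans cK.
by have := hK1 K KK1; rewrite ler_pdivrMr ?subr_gt0//; lra.
Qed.

Lemma leap_error_frequently_ge d t alpha (a : R) (e : bool) M :
  digit_seq d -> pierce_tails R d t ->
  (0 <= alpha)%E -> log_digits_rate d alpha -> 0 < a -> (a%:E < leap_rate alpha)%E ->
  exists2 N, (M <= N)%N &
    a <= (-1) ^+ e * ((N%:R * t 0%N - (leap_count (t 0%N) N)%:R) / Num.sqrt (ln N%:R)).
Proof.
move=> dd dt al0 [_ hhi] a0 /(lt_leap_rate _ _ al0 a0)[b [b0 hb] bal].
have [K0 hK0] := hhi b bal.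
pose c := a * Num.sqrt (b / 2).
have c0 : 0 <= c by rewrite mulr_ge0 ?(ltW a0) ?sqrtr_ge0.
have c2 : c < 2^-1.
  have : c ^+ 2 = a ^+ 2 * (b / 2) by rewrite exprMn sqr_sqrtr ?divr_ge0 ?(ltW b0).
  by nra.
pose eta := 2^-1 - c; have eta0 : 0 < eta by rewrite subr_gt0.
(* The target is [2 sqrt K + 3 / 2 <= eta K]. The threshold gives [sqrt K >= 4 / eta + 1], hence
   [eta K >= 4 sqrt K] and [sqrt K >= 1]. *)
have [K1 hK1] := archi_nat ((4 / eta + 1) ^+ 2).
(* The margin 4 makes the year at least [M + 2], so that [ln N > 0]. *)
pose K := (maxn M.+4 (maxn K0 K1)).
have [KM KK0 KK1] : [/\ (M.+4 <= K)%N, (K0 <= K)%N & (K1 <= K)%N].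
  by rewrite /K !leq_max !leqnn ?orbT.
exists (extremal_year d e K).
  have := extremal_year_ge d e K.-2 dd.
  by rewrite (_ : K.-2.+2 = K); lia.
have := extremal_year_error R d t e K dd dt _ erefl.
have NP := extremal_year_lt d e K dd.
have N2 : (2 <= extremal_year d e K)%N.
  have := extremal_year_ge d e K.-2 dd.
  by rewrite (_ : K.-2.+2 = K); lia.
set N := extremal_year d e K in NP N2 *; set E := N%:R * _ - _ => hE.
have lnN : (ln N%:R : R) <= b * K%:R ^+ 2 / 2.
  apply: le_trans (hK0 K KK0); rewrite -ln_digit_prod// ler_ln ?posrE ?ltr0n ?digit_prod_gt0//.
    by rewrite ler_nat ltnW.
  by apply: leq_trans N2.
have lnN0 : 0 < ln N%:R :> R by rewrite ln_gt0// ltr1n.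
have cK : a * Num.sqrt (ln N%:R) <= c * K%:R.
  rewrite -mulrA ler_pM2l//; apply: le_trans (ler_wsqrtr lnN) _.
  have -> : b * K%:R ^+ 2 / 2 = b / 2 * K%:R ^+ 2 by ring.
  by rewrite [Num.sqrt (_ * _ ^+ 2)]sqrtrM ?divr_ge0 ?(ltW b0)// sqrtr_sqr ger0_norm.
rewrite mulrA ler_pdivlMr ?sqrtr_gt0//; apply: le_trans cK _; apply: le_trans hE.
have hs := sum_inv_digits d K dd.
have s2 : Num.sqrt K%:R ^+ 2 = K%:R :> R by rewrite sqr_sqrtr.
have sK : 4 / eta + 1 <= Num.sqrt K%:R.
  have -> : 4 / eta + 1 = Num.sqrt ((4 / eta + 1) ^+ 2).
    by rewrite sqrtr_sqr ger0_norm// addr_ge0// divr_ge0// ltW.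
  by rewrite ler_wsqrtr// hK1.
have q0 : 0 < 4 / eta by rewrite divr_gt0.
have s4 : 4 <= eta * Num.sqrt K%:R.
  have : 4 / eta <= Num.sqrt K%:R by lra.
  by rewrite ler_pdivrMr// mulrC.
have e2 : eta * K%:R = eta * Num.sqrt K%:R * Num.sqrt K%:R by rewrite -mulrA -expr2 s2.
have h4 : 4 * Num.sqrt K%:R <= eta * Num.sqrt K%:R * Num.sqrt K%:R.
  by rewrite ler_wpM2r ?sqrtr_ge0.
have e3 : eta * K%:R = K%:R / 2 - c * K%:R by rewrite /eta; ring.
lra.
Qed.

Lemma leap_set_rate d t alpha (x : unit_interval R) :
  digit_seq d -> pierce_tails R d t -> (0 <= alpha)%E -> log_digits_rate d alpha ->
  val x = t 0%N -> leap_set alpha x.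
Proof.
move=> dd dt al0 hr xt; rewrite /leap_set /= xt.
have up a := leap_error_eventually_le d t alpha a dd dt al0 hr.
have lo (e : bool) (a : R) M : (a%:E < leap_rate alpha)%E -> exists2 N, (M <= N)%N &
    a <= (-1) ^+ e * ((N%:R * t 0%N - (leap_count (t 0%N) N)%:R) / Num.sqrt (ln N%:R)).
  (* The frequent lower bound requires a positive threshold. If the rate is 0, then [a < 0] and the
     two-sided upper bound for [- a] applies instead; if the rate is positive and [a <= 0], a
     positive real below the rate replaces [a]. *)
  move=> ha; have [r0|r0] := eqVneq (leap_rate alpha) 0%E.
    have : (leap_rate alpha < (- a)%:E)%E.
      by move: ha; rewrite r0 !lte_fin oppr_gt0.
    move=> /(leap_error_eventually_le d t alpha _ dd dt al0 hr)[M' hM'].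
    exists (maxn M M'); first exact: leq_maxl.
    have := hM' _ (leq_maxr M M'); rewrite ler_norml opprK => /andP[h1 h2].
    by case: e; rewrite ?expr1 ?expr0 ?mulN1r ?mul1r //; lra.
  have rp : (0 < leap_rate alpha)%E by rewrite lt_neqAle eq_sym r0 leap_rate_ge0.
  have : exists2 a' : R, 0 < a' /\ a <= a' & (a'%:E < leap_rate alpha)%E.
    have [a0|a0] := ltP 0 a; first by exists a.
    have [c /andP[c0 cr]] := lte_dense_real _ _ rp.
    by exists c => //; split; [rewrite -lte_fin | rewrite (le_trans a0)// -lee_fin ltW].
  case=> a' [a'0 aa'] a'r.
  have [N MN hN] := leap_error_frequently_ge d t alpha a' e M dd dt al0 hr a'0 a'r.
  by exists N => //; exact: le_trans hN.
split.
  apply: limn_esup_eq => [a /up[M hM]|a M /(lo false a M)[N MN hN]].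
    by exists M => N /hM; rewrite ler_norml => /andP[_]; rewrite lee_fin.
  by exists N => //; rewrite lee_fin; move: hN; rewrite expr0 mul1r.
(* The liminf is the opposite of the limsup of the opposite sequence, whose lower bounds come from
   [e = true]. *)
rewrite /limn_einf; congr (- _)%E.
apply: limn_esup_eq => [a /up[M hM]|a M /(lo true a M)[N MN hN]].
  exists M => N /hM; rewrite ler_norml => /andP[h _].
  by rewrite -EFinN lee_fin lerNl.
by exists N => //; rewrite -EFinN lee_fin; move: hN; rewrite expr1 mulN1r.
Qed.

End LimsupError.

(** * Hausdorff dimension of subsets of the line *)

Section HausdorffDimension.
Variable R : realType.
Local Open Scope ring_scope.
Implicit Types (A E : set R).

Lemma le_diameter A (x y : R) : A x -> A y -> (`|x - y|%:E <= diameter A)%E.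
Proof.
move=> Ax Ay; rewrite /diameter le_max; apply/orP; right.
by apply: ereal_sup_ubound; exists x => //; exists y.
Qed.

Lemma diameter_ge0 A : (0 <= diameter A)%E.
Proof. by rewrite /diameter le_max lexx. Qed.

Lemma diameter_le A (r : R) : 0 <= r -> (forall x y, A x -> A y -> `|x - y| <= r) ->
  (diameter A <= r%:E)%E.
Proof.
move=> r0 h; rewrite /diameter ge_max lee_fin r0 /=.
by apply: ge_ereal_sup => _ [x Ax [y Ay <-]]; rewrite lee_fin h.
Qed.

Lemma diameter_pow_ge0 (s : R) A : (0 <= diameter_pow s A)%E.
Proof. by rewrite /diameter_pow; case: ifP => // _; exact: poweR_ge0. Qed.

Lemma diameter_pow_le (s : R) A (r : R) : 0 <= s -> 0 <= r ->
  (forall x y, A x -> A y -> `|x - y| <= r) ->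
  (diameter_pow s A <= (r `^ s)%:E)%E.
Proof.
move=> s0 r0 h; rewrite /diameter_pow; case: ifP => _; first by rewrite lee_fin powR_ge0.
rewrite -poweR_EFin gt0_ler_poweR//= ?in_itv/= ?leey ?andbT ?diameter_ge0//.
exact: diameter_le.
Qed.

Lemma hausdorff_premeasure_ge0 (s delta : R) A : (0 <= hausdorff_premeasure s delta A)%E.
Proof.
apply: le_ereal_inf_tmp => _ [F _ <-].
by apply: nneseries_ge0 => i _ _; exact: diameter_pow_ge0.
Qed.

(** Covering [[0, 1]] by [N + 1] intervals of length [1 / N] costs [(N + 1) N^(-s) <= 2 N^(1 - s)],
    which tends to 0. *)
Lemma hausdorff_measure_unit (s : R) A : 1 < s -> A `<=` unit_interval R ->
  hausdorff_measure s A = 0%E.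
Proof.
move=> s1 AI; apply/eqP; rewrite eq_le; apply/andP; split; last first.
  apply: le_trans (hausdorff_premeasure_ge0 s 1 A) _.
  by apply: ereal_sup_ubound; exists 1 => //=.
apply: ge_ereal_sup => _ [delta /= d0 <-]; apply/lee_addgt0Pr => e e0; rewrite add0e.
(* With [N = n + 1], the two bounds mean [1 / N <= delta] and [2 N^(1 - s) <= e]. *)
have [n hn] : exists n : nat, Num.max delta^-1 ((2 / e) `^ (s - 1)^-1) <= n.+1%:R.
  exists (Num.truncn (Num.max delta^-1 ((2 / e) `^ (s - 1)^-1))).
  exact/ltW/truncnS_gt.
move: hn; rewrite ge_max => /andP[hn1 hn2].
pose N : R := n.+1%:R; have N0 : 0 < N by rewrite ltr0n.
(* The last index [n + 1 = N] is there to catch [x = 1]. *)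
pose F (i : nat) : set R :=
  if (i < n.+2)%N then [set x | i%:R <= N * x <= i.+1%:R] else set0.
have FN i x y : F i x -> F i y -> `|x - y| <= N^-1.
  rewrite /F; case: ifP => // _ /andP[a b] /andP[a' b'].
  rewrite -[leRHS]mul1r ler_pdivlMr// -(ger0_norm (ltW N0)) -normrM mulrBl.
  by rewrite ![_ * N]mulrC ler_norml; rewrite -natr1 in b b'; apply/andP; split; lra.
have Ninv : N^-1 <= delta by rewrite -(invrK delta) lef_pV2 ?posrE ?invr_gt0.
apply: (@le_trans _ _ (\sum_(0 <= i <oo) diameter_pow s (F i))%E).
  apply: ereal_inf_lbound; exists F => //; split=> [i|x /AI].
    apply: (@le_trans _ _ (N^-1)%:E); last by rewrite lee_fin.
    by apply: diameter_le; [rewrite invr_ge0 ltW | exact: FN].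
  rewrite /unit_interval /= in_itv /= => /andP[x0 x1].
  have Nx0 : 0 <= N * x by rewrite mulr_ge0// ltW.
  have /andP[t0 t1] := truncn_itv Nx0.
  exists (Num.truncn (N * x)) => //; rewrite /F ifT /=; first by rewrite t0 ltW.
  by rewrite truncn_lt_nat// (@le_lt_trans _ _ N) ?ltr_nat// ler_piMr// ltW.
rewrite (nneseries_split 0 n.+2); last by move=> i _; exact: diameter_pow_ge0.
rewrite [X in (_ + X)%E]eseries0 ?adde0; last first.
  by move=> i; rewrite add0n => ni _; rewrite /F ltnNge ni /= /diameter_pow eqxx.
rewrite add0n.
apply: (@le_trans _ _ (\sum_(0 <= i < n.+2) ((N^-1) `^ s)%:E)%E).
  apply: lee_sum => i _; apply: diameter_pow_le; last exact: FN.
    by rewrite ltW// (lt_trans _ s1).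
  by rewrite invr_ge0 ltW.
rewrite sumEFin lee_fin sumr_const_nat subn0.
have -> : N^-1 `^ s = N^-1 * (N `^ (s - 1))^-1.
  rewrite -invfM mulr_powRB1 ?(ltW N0) ?(lt_trans _ s1)//.
  by rewrite -powR_inv1 ?(ltW N0)// -powRrM mulN1r powRN.
rewrite -mulr_natl mulrA.
have : 2 / e <= N `^ (s - 1).
  have -> : 2 / e = ((2 / e) `^ (s - 1)^-1) `^ (s - 1).
    by rewrite -powRrM mulVf ?gt_eqF ?subr_gt0// powRr1 ?divr_ge0 ?(ltW e0).
  by rewrite ge0_ler_powR ?nnegrE ?subr_ge0 ?powR_ge0 ?(ltW s1) ?(ltW N0).
set p := N `^ _ => hp.
have p0 : 0 < p by exact: powR_gt0.
rewrite ler_pdivrMr//; apply: (@le_trans _ _ 2); last first.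
  by move: hp; rewrite ler_pdivrMr// mulrC.
rewrite ler_pdivrMr// /N -natrM ler_nat; lia.
Qed.

Lemma hausdorff_dim_le1 A : A `<=` unit_interval R -> (hausdorff_dim A <= 1)%E.
Proof.
move=> AI; apply/lee_addgt0Pr => e e0; apply: ereal_inf_lbound; exists (1 + e) => //.
have s1 : 1 < 1 + e by rewrite ltrDl.
by split; [rewrite ltW// (lt_trans _ s1) | exact: hausdorff_measure_unit].
Qed.

(* A parametrization of part of E by [0, 1) whose inverse is s-Hoelder plays the
   role of a mass distribution: a cover of E pulls back to a cover of [0, 1). *)
Lemma hausdorff_measure_gt0 E (g : R -> R) (s C : R) : 0 <= s -> 0 < C ->
  (forall y, 0 <= y < 1 -> E (g y)) ->
  (forall y y', 0 <= y < 1 -> 0 <= y' < 1 -> `|y - y'| <= C * `|g y - g y'| `^ s) ->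
  (0 < hausdorff_measure s E)%E.
Proof.
(* The measure is a supremum over scales, so the single scale 1 suffices; it also keeps the
   diameters finite. *)
move=> s0 C0 gE gC; apply: (@lt_le_trans _ _ (hausdorff_premeasure s 1 E)); last first.
  by apply: ereal_sup_ubound; exists 1 => //=.
have C2 : 0 < 2 * C by rewrite mulr_gt0.
apply: (@lt_le_trans _ _ ((2 * C)^-1)%:E); first by rewrite lte_fin invr_gt0.
apply: le_ereal_inf_tmp => _ [F [Fd EF] <-].
have /choice[I hI] i : exists I : set (measurableTypeR R),
    [/\ measurable I, (forall y, 0 <= y < 1 -> F i (g y) -> I y) &
      (lebesgue_measure I <= (2 * C)%:E * diameter_pow s (F i))%E].
  have [[y0 [y01 Fy0]]|no] := pselect (exists y, 0 <= y < 1 /\ F i (g y)); last first.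
    exists set0; split => //; first by move=> y y01 Fy; case: no; exists y.
    by rewrite measure0 mule_ge0 ?diameter_pow_ge0// lee_fin ltW.
  have dfin : diameter (F i) \is a fin_num.
    by rewrite ge0_fin_numE ?diameter_ge0// (le_lt_trans (Fd i))// ltry.
  pose r := C * (fine (diameter (F i))) `^ s.
  have r0 : 0 <= r by rewrite mulr_ge0 ?powR_ge0 ?ltW.
  exists `[y0 - r, y0 + r]%classic; split=> [||].
  - exact: measurable_itv.
  - move=> y y01' Fy; rewrite /= in_itv /= -ler_distl; apply: le_trans (gC _ _ y01' y01) _.
    rewrite ler_pM2l// ge0_ler_powR ?nnegrE ?normr_ge0 ?fine_ge0 ?diameter_ge0//.
    by rewrite -lee_fin fineK// le_diameter.
  - rewrite lebesgue_measure_itv /= lte_fin.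
    have -> : (if y0 - r < y0 + r then ((y0 + r)%:E - (y0 - r)%:E)%E else 0%E) = (2 * r)%:E.
      case: ltP => [_|h]; first by rewrite -EFinB; congr EFin; ring.
      by have -> : r = 0; [lra | rewrite mulr0].
    rewrite /diameter_pow ifF; last by apply/negbTE/set0P; exists (g y0).
    by rewrite -[diameter _]fineK// poweR_EFin -EFinM lee_fin /r mulrA.
have : (lebesgue_measure (`[0%R, 1%R[%classic : set (measurableTypeR R)) <=
    \sum_(0 <= i <oo) lebesgue_measure (I i))%E.
  apply: measure_sigma_subadditive.
  - by move=> i; have [] := hI i.
  - exact: measurable_itv.
  - move=> y /=; rewrite in_itv /= => y01.
    have [i _ Fi] := EF _ (gE _ y01).
    by exists i => //; have [_ h _] := hI i; exact: h.
rewrite lebesgue_measure_itv /= lte_fin ltr01 sube0 => h1.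
have h2 : (1 <= (2 * C)%:E * \sum_(0 <= i <oo) diameter_pow s (F i))%E.
  rewrite -nneseriesZl; last by move=> i _; exact: diameter_pow_ge0.
  apply: le_trans h1 _; apply: lee_nneseries => // i _.
  by have [] := hI i.
by rewrite -[((2 * C)^-1)%:E]mule1 lee_pdivrMl.
Qed.

Lemma hausdorff_dim_ge1 E (g : R -> R) :
  (forall y, 0 <= y < 1 -> E (g y)) ->
  (forall s, 0 <= s < 1 -> exists2 C, 0 < C & forall y y', 0 <= y < 1 -> 0 <= y' < 1 ->
    `|y - y'| <= C * `|g y - g y'| `^ s) ->
  (1 <= hausdorff_dim E)%E.
Proof.
move=> gE gC; apply: le_ereal_inf_tmp => _ [s [s0 Hs] <-]; rewrite lee_fin leNgt.
apply/negP => s1; have [C C0 hC] := gC s (introT andP (conj s0 s1)).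
by have := hausdorff_measure_gt0 E g s C s0 C0 gE hC; rewrite Hs ltxx.
Qed.

End HausdorffDimension.

(** * Mixed radix expansions of reals in [[0, 1)] *)

Section MixedRadix.
Variable R : realType.
Local Open Scope ring_scope.
Implicit Types (n : nat -> nat) (y : R).

(** These are the successive fractional parts in the Cantor series expansion of [y] with radices
    [n]. *)
Fixpoint radix_tail n y k : R :=
  if k is k'.+1 then
    let z := (n k')%:R * radix_tail n y k' in z - (Num.truncn z)%:R
  else y.

Definition radix_digit n y k := Num.truncn ((n k)%:R * radix_tail n y k).

Lemma radix_tail_itv n y k : 0 <= y < 1 -> 0 <= radix_tail n y k < 1.
Proof.
move=> y01; elim: k => // k /andP[h0 h1] /=.
have z0 : 0 <= (n k)%:R * radix_tail n y k by rewrite mulr_ge0 ?ler0n.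
have /andP[t0 t1] := truncn_itv z0.
by rewrite subr_ge0 t0 ltrBlDl natr1.
Qed.

Lemma radix_digit_lt n y k : (0 < n k)%N -> 0 <= y < 1 -> (radix_digit n y k < n k)%N.
Proof.
move=> nk /(radix_tail_itv n _ k)/andP[h0 h1].
by rewrite truncn_lt_nat ?mulr_ge0 ?ler0n// -[ltRHS]mulr1 ltr_pM2l ?ltr0n.
Qed.

(** Equal digits cancel, so [y - y'] times the product of the radices is a difference of two tails
    in [[0, 1)]. *)
Lemma radix_prefix_sub n y y' k : (forall i, (0 < n i)%N) -> 0 <= y < 1 -> 0 <= y' < 1 ->
  (forall i, (i < k)%N -> radix_digit n y i = radix_digit n y' i) ->
  `|y - y'| <= ((\prod_(i < k) n i)%N%:R)^-1.
Proof.
move=> n0 y01 y01' e.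
have P0 j : 0 < (\prod_(i < j) n i)%N%:R :> R by rewrite ltr0n prodn_gt0.
have h : (y - y') * (\prod_(i < k) n i)%N%:R = radix_tail n y k - radix_tail n y' k.
  elim: k e => [|k IH] e; first by rewrite big_ord0 mulr1.
  rewrite big_ord_recr /= natrM mulrA IH; last by move=> i ik; apply: e; rewrite ltnS ltnW.
  have := e k (ltnSn k); rewrite /radix_digit => ->.
  by ring.
rewrite -[leRHS]mul1r ler_pdivlMr// -(ger0_norm (ltW (P0 k))) -normrM h.
have /andP[a b] := radix_tail_itv n _ k y01; have /andP[a' b'] := radix_tail_itv n _ k y01'.
by rewrite ler_norml; apply/andP; split; lra.
Qed.

End MixedRadix.

(** * Digits confined to successive windows *)

Section Windows.
Variable R : realType.
Local Open Scope ring_scope.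
Implicit Types (M B : nat -> nat) (d : nat -> nat) (t : nat -> R).

Definition digit_windows M B := forall i, (M i < B i <= M i.+1)%N.

Definition in_windows M B d := forall i, (M i < d i <= B i)%N.

Lemma in_windows_digit_seq M B d : digit_windows M B -> in_windows M B d -> digit_seq d.
Proof.
move=> w dw; split; first by have /andP[h _] := dw 0%N; apply: leq_ltn_trans h.
move=> i; have /andP[_ h1] := dw i; have /andP[h2 _] := dw i.+1.
by have /andP[_ h3] := w i; apply: leq_ltn_trans h2; apply: leq_trans h3.
Qed.

Definition window_digits M B (y : R) i :=
  (M i + (radix_digit R (fun j => B j - M j)%N y i).+1)%N.

Lemma window_digits_in M B y : digit_windows M B -> 0 <= y < 1 ->
  in_windows M B (window_digits M B y).
Proof.
move=> w y01 i; have /andP[MB _] := w i.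
have h : (0 < B i - M i)%N by rewrite subn_gt0.
have := radix_digit_lt R (fun j => B j - M j)%N y i h y01.
by rewrite /window_digits; lia.
Qed.

(** The smaller digit gives the larger tail: with [a = d k] and [b = d' k], the tails differ by at
    least [(b^2 - a (b + 1)) / (a b (b + 1))]. Since [a (b + 1) < b^2], the numerator is at least 1
    and the denominator at most [b^3]. *)
Lemma window_separation M B d d' t t' k : digit_windows M B ->
  in_windows M B d -> in_windows M B d' -> pierce_tails R d t -> pierce_tails R d' t' ->
  (forall i, (i < k)%N -> d i = d' i) -> (d k < d' k)%N ->
  (((\prod_(i < k) B i) * B k ^ 3)%N%:R)^-1 <= `|t 0%N - t' 0%N|.
Proof.
move=> w dw dw' dt dt' e lt.
have dd := in_windows_digit_seq M B d w dw; have dd' := in_windows_digit_seq M B d' w dw'.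
rewrite (pierce_prefix_sub R d d' t t' k)//.
have Bp i : (0 < B i)%N by have /andP[h _] := w i; apply: leq_ltn_trans h.
have PB : (digit_prod d k <= \prod_(i < k) B i)%N.
  by apply: leq_prod => i _; have /andP[] := dw i.
rewrite natrM invfM mulrC; apply: ler_pM; rewrite ?invr_ge0 ?ler0n//; last first.
  have P0 := digit_prod_gt0 d k dd.
  by rewrite lef_pV2 ?posrE ?ltr0n ?ler_nat// (leq_trans P0).
(* The next digit of [d] exceeds even [d' k], which lies in the window below it; this keeps [t k.+1]
   small. *)
have d1 : ((d' k).+1 <= d k.+1)%N.
  have /andP[_ h1] := dw' k; have /andP[h2 _] := dw k.+1; have /andP[_ h3] := w k.
  lia.
have [_ e1] := dt k; have [/andP[_ h1] _] := dt k.+1; have [/andP[_ h2] _] := dt' k.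
have a0 := digit_seqR_gt0 R d k dd; have b0 := digit_seqR_gt0 R d' k dd'.
have h3 : t k.+1 <= (d' k).+1%:R^-1.
  by apply: le_trans h1 _; rewrite lef_pV2 ?posrE ?digit_seqR_gt0 ?ltr0Sn ?ler_nat.
apply: le_trans (ler_norm _).
have h4 : (1 - (d' k).+1%:R^-1) / (d k)%:R - (d' k)%:R^-1 <= t k - t' k.
  apply: lerB => //; by rewrite ler_pdivrMr// e1 lerD2l lerN2.
apply: le_trans h4.
have -> : (1 - (d' k).+1%:R^-1) / (d k)%:R - (d' k)%:R^-1 =
   ((d' k)%:R ^+ 2 - (d k)%:R * ((d' k)%:R + 1))
     / ((d k)%:R * (d' k)%:R * ((d' k)%:R + 1)) :> R.
  by rewrite -natr1; field; rewrite !gt_eqF// addr_gt0.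
have h5 : ((d' k)%:R ^+ 2 - (d k)%:R * ((d' k)%:R + 1)) >= 1 :> R.
  by rewrite lerBrDl natr1 -natrM -natrX natr1 ler_nat; nia.
rewrite -[leLHS]mul1r; apply: ler_pM => //.
rewrite natr1 -!natrM lef_pV2 ?posrE ?ltr0n ?ler_nat ?muln_gt0 ?expn_gt0 ?Bp//.
  have /andP[_ h] := dw' k.
  have h6 : (d k * (d' k).+1 <= d' k * d' k)%N by nia.
  by rewrite mulnAC !expnS expn0 muln1 mulnA leq_mul// (leq_trans h6)// leq_mul.
by rewrite -!(ltr0n R) a0 b0 ltr0Sn.
Qed.

(** On the left stands the inverse of the distance in [window_separation], on the right the number
    of prefixes of length [k]. *)
Definition window_growth M B := forall s : R, 0 <= s < 1 ->
  exists2 C : R, 0 < C & forall k,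
    (((\prod_(i < k) B i) * B k ^ 3)%N%:R) `^ s <= C * (\prod_(i < k) (B i - M i))%N%:R.

(** Let [k] be the first position where the digits differ. The parameters are then at distance at
    most the inverse of the number of prefixes, the images are apart by [window_separation], and
    [window_growth] compares the two. *)
Lemma window_param_holder M B (T : R -> nat -> R) :
  digit_windows M B -> window_growth M B ->
  (forall y, 0 <= y < 1 -> pierce_tails R (window_digits M B y) (T y)) ->
  forall s : R, 0 <= s < 1 -> exists2 C, 0 < C & forall y y', 0 <= y < 1 -> 0 <= y' < 1 ->
    `|y - y'| <= C * `|T y 0%N - T y' 0%N| `^ s.
Proof.
move=> w gr hT s s01; have [C C0 hC] := gr s s01; exists C => // y y' y01 y01'.
have [<-|yy'] := eqVneq y y'; first by rewrite subrr normr0 mulr_ge0 ?powR_ge0 ?(ltW C0).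
have Bp i : (0 < B i)%N by have /andP[h _] := w i; apply: leq_ltn_trans h.
have np i : (0 < B i - M i)%N.
  by have /andP[h _] := w i; rewrite subn_gt0.
pose n i := (B i - M i)%N.
have Pn0 k : 0 < (\prod_(i < k) n i)%N%:R :> R.
  by rewrite ltr0n; apply: prodn_gt0 => i; exact: np.
have Bge k : (k < B k)%N.
  elim: k => [|k IH]; first exact: Bp.
  have /andP[_ h1] := w k; have /andP[h2 _] := w k.+1.
  by apply: leq_ltn_trans h2; apply: leq_trans h1.
(* Distinct parameters have distinct digits because the number of prefixes is unbounded: the growth
   condition with exponent [1 / 2] makes it at least [(k + 1) / D]. *)
have ex : exists k, radix_digit R n y k != radix_digit R n y' k.
  apply: contrapT => no.
  have same i : radix_digit R n y i = radix_digit R n y' i.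
    by apply/eqP; apply: contra_notT no => ne; exists i.
  have half : 0 <= (2^-1 : R) < 1 by apply/andP; split; lra.
  have [D D0 hD] := gr _ half.
  have yp : 0 < `|y - y'| by rewrite normr_gt0 subr_eq0.
  pose k := Num.truncn (D / `|y - y'|).
  have h1 := radix_prefix_sub R n y y' k np y01 y01' (fun i _ => same i).
  have h2 : k.+1%:R <= D * (\prod_(i < k) n i)%N%:R.
    apply: le_trans (hD k).
    have -> : k.+1%:R = (k.+1%:R ^+ 2) `^ 2^-1 :> R.
      by rewrite -powR_mulrn// -powRrM mulfV ?powRr1.
    rewrite ge0_ler_powR ?nnegrE ?exprn_ge0 ?invr_ge0 ?ler0n//.
    have := Bge k; have : (0 < \prod_(i < k) B i)%N by rewrite prodn_gt0.
    move: (B k) (\prod_(i < k) B i)%N => b P P0 kb.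
    rewrite -natrX ler_nat (leq_trans _ (leq_pmull _ P0))//.
    by apply: (@leq_trans (b ^ 2)); [rewrite leq_exp2r | rewrite leq_pexp2l// (leq_trans _ kb)].
  have h3 : D / `|y - y'| < k.+1%:R by exact: truncnS_gt.
  have h4 : `|y - y'| * (\prod_(i < k) n i)%N%:R <= 1 by rewrite -ler_pdivlMr// mul1r.
  move: h3; rewrite ltr_pdivrMr// => h3.
  have := ler_wpM2l (ltW D0) h4; rewrite mulr1 => h5.
  have h6 := ler_wpM2l (ltW yp) h2.
  have : D < D by apply: lt_le_trans h3 _; rewrite mulrC; apply: le_trans h6 _; rewrite mulrCA.
  by rewrite ltxx.
case: (ex_minnP ex) => k nek mink.
have same i : (i < k)%N -> radix_digit R n y i = radix_digit R n y' i.
  by move=> ik; apply/eqP; apply: contraTT ik => /mink; rewrite -leqNgt.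
have dw := window_digits_in M B y w y01; have dw' := window_digits_in M B y' w y01'.
have samed i : (i < k)%N -> window_digits M B y i = window_digits M B y' i.
  by move=> /same e; rewrite /window_digits -/n e.
have sep : (((\prod_(i < k) B i) * B k ^ 3)%N%:R)^-1 <= `|T y 0%N - T y' 0%N|.
  have : window_digits M B y k != window_digits M B y' k.
    by rewrite /window_digits -/n eqn_add2l eqSS.
  rewrite neq_ltn => /orP[lt|lt].
    by apply: (window_separation M B _ _ _ _ k w dw dw' (hT y y01) (hT y' y01')).
  rewrite distrC.
  apply: (window_separation M B _ _ _ _ k w dw' dw (hT y' y01') (hT y y01)) => // i ik.
  by rewrite samed.
set Q := (_ * _)%N in sep; have Q0 : 0 < Q%:R :> R.
  by rewrite ltr0n /Q muln_gt0 prodn_gt0//= expn_gt0 Bp.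
apply: le_trans (radix_prefix_sub R n y y' k np y01 y01' same) _.
have s0 : 0 <= s by case/andP: s01.
apply: (@le_trans _ _ (C * (Q%:R^-1) `^ s)); last first.
  by rewrite ler_pM2l// ge0_ler_powR ?nnegrE ?invr_ge0 ?ler0n.
have -> : Q%:R^-1 `^ s = (Q%:R `^ s)^-1 :> R.
  by rewrite -powR_inv1 ?ler0n// -powRrM mulN1r powRN.
by rewrite ler_pdivlMr ?powR_gt0// mulrC ler_pdivrMr//; exact: hC.
Qed.

End Windows.

(** * Windows of prescribed logarithmic growth *)

Section Growth.
Variable R : realType.
Local Open Scope ring_scope.
Implicit Types (alpha : \bar R).

Lemma bounded_below_from (f : nat -> R) K0 c : (forall k, (K0 <= k)%N -> c <= f k) ->
  exists c', forall k, c' <= f k.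
Proof.
elim: K0 c => [|K0 IH] c h; first by exists c => k; exact: h.
apply: (IH (Num.min c (f K0))) => k; rewrite leq_eqVlt => /predU1P[<-|hk].
  by rewrite ge_min lexx orbT.
by rewrite ge_min h.
Qed.

Lemma sum_bounded_below (f : nat -> R) J : (forall j, (J <= j)%N -> 0 <= f j) ->
  exists c, forall k, c <= \sum_(j < k) f j.
Proof.
move=> h; apply: (@bounded_below_from _ J (\sum_(j < J) f j)) => k /subnKC <-.
elim: (k - J)%N => [|i IH]; first by rewrite addn0.
by rewrite addnS big_ord_recr /= ler_wpDr// h// leq_addr.
Qed.

Lemma sum_nat_id K : \sum_(j < K) (j%:R : R) = K%:R * (K%:R - 1) / 2.
Proof.
elim: K => [|K IH]; first by rewrite big_ord0 !mul0r.
by rewrite big_ord_recr /= IH -[K.+1%:R]natr1; field.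
Qed.

(** The slack [(b' - b) K^2 / 2] eventually absorbs the finitely many early terms and the linear
    part of [b' K (K - 1) / 2]. *)
Lemma sum_ge_quadratic (u : nat -> R) (b b' : R) J : b < b' ->
  (forall j, (J <= j)%N -> b' * j%:R <= u j) ->
  exists K0, forall K, (K0 <= K)%N -> b * K%:R ^+ 2 / 2 <= \sum_(j < K) u j.
Proof.
move=> bb' h.
have [j Jj|c hc] := sum_bounded_below (fun j => u j - b' * j%:R) J.
  by rewrite subr_ge0 h.
have [K0 hK0] := archi_nat R ((`|b'| + 2 * `|c|) / (b' - b)).
exists K0.+1 => K hK; have := hc K; rewrite sumrB -mulr_sumr sum_nat_id => {}hc.
have := hK0 K (ltnW hK); rewrite ler_pdivrMr ?subr_gt0// => h2.
have K1 : 1 <= K%:R :> R by rewrite ler1n; exact: leq_trans hK.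
have h3 := ler_norm b'; have h4 := ler_norm (- c); rewrite normrN in h4.
have h5 := normr_ge0 b'; have h6 := normr_ge0 c.
set x := K%:R in h2 K1 hc *; set S := \sum_(i < K) u i in hc *.
have h7 : (`|b'| + 2 * `|c|) * x <= (x * (b' - b)) * x by rewrite ler_wpM2r//; lra.
have h8 : 2 * `|c| <= 2 * `|c| * x by rewrite ler_peMr//; lra.
have h9 : b' * x <= `|b'| * x by rewrite ler_wpM2r//; lra.
have e1 : b' * (x * (x - 1) / 2) = (b' * x * x - b' * x) / 2 by ring.
have e2 : b * x ^+ 2 / 2 = (b' * x * x - (x * (b' - b)) * x) / 2 by ring.
rewrite e1 in hc; rewrite e2; lra.
Qed.

Lemma sum_le_quadratic (u : nat -> R) (b b' : R) J : b' < b ->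
  (forall j, (J <= j)%N -> u j <= b' * j%:R) ->
  exists K0, forall K, (K0 <= K)%N -> \sum_(j < K) u j <= b * K%:R ^+ 2 / 2.
Proof.
move=> bb' h.
have [||K0 hK0] := sum_ge_quadratic (fun j => - u j) (- b) (- b') J.
- by rewrite ltrN2.
- by move=> j /h; rewrite mulNr lerN2.
exists K0 => K /hK0; rewrite sumrN !mulNr lerN2; exact.
Qed.

(* The term 2 sqrt k does not change the rate alpha, but it makes the bounds grow
   superpolynomially, with gaps of nearly full size, even when alpha = 0. *)
Definition log_bound alpha k : R :=
  2 * Num.sqrt k%:R + (if alpha is r%:E then r * k%:R else k%:R ^+ 2).

Lemma log_bound_ge alpha k : (0 <= alpha)%E -> 2 * Num.sqrt k%:R <= log_bound alpha k.
Proof.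
rewrite /log_bound lerDl; case: alpha => [r||]// r0.
by rewrite mulr_ge0.
Qed.

(** The increment of [2 sqrt k] alone is large enough, as the other term is nondecreasing. *)
Lemma log_bound_step alpha k : (0 <= alpha)%E ->
  (Num.sqrt k.+1%:R)^-1 <= log_bound alpha k.+1 - log_bound alpha k.
Proof.
move=> al0; rewrite /log_bound.
set x := Num.sqrt k.+1%:R; set y := Num.sqrt k%:R.
have xy : x ^+ 2 - y ^+ 2 = 1 by rewrite !sqr_sqrtr// -natrB// subSnn.
have y0 : 0 <= y by exact: sqrtr_ge0.
have x1 : 1 <= x by rewrite -sqrtr1 ler_wsqrtr// ler1n.
have yx : y <= x by rewrite ler_wsqrtr// ler_nat.
have h1 : x^-1 <= 2 * x - 2 * y.
  by rewrite -[leLHS]mul1r ler_pdivrMr ?(lt_le_trans _ x1)//; nra.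
apply: le_trans h1 _.
have -> (a b a' b' : R) : a + a' - (b + b') = a - b + (a' - b') by ring.
rewrite lerDl subr_ge0; case: alpha al0 => [r||]// r0.
  by rewrite ler_wpM2l ?ler_nat.
by rewrite lerXn2r ?nnegrE ?ler_nat.
Qed.

(** Each term of [log_bound] is a nonnegative multiple of a power of [k] with exponent at most 2, so
    its quotient by [k^2] does not increase. The form without division covers [j = 0]. *)
Lemma log_bound_ratio alpha j k : (0 <= alpha)%E -> (j <= k)%N ->
  j%:R ^+ 2 * log_bound alpha k <= k%:R ^+ 2 * log_bound alpha j.
Proof.
move=> al0 jk; rewrite /log_bound !mulrDr; apply: lerD.
  set x := Num.sqrt j%:R; set y := Num.sqrt k%:R.
  have -> : j%:R = x ^+ 2 by rewrite sqr_sqrtr.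
  have -> : k%:R = y ^+ 2 by rewrite sqr_sqrtr.
  have x0 : 0 <= x by exact: sqrtr_ge0.
  have xy : x <= y by rewrite ler_wsqrtr// ler_nat.
  have h : x ^+ 3 <= y ^+ 3 by rewrite lerXn2r ?nnegrE// (le_trans x0).
  have h2 : 0 <= 2 * x * y by rewrite !mulr_ge0// (le_trans x0).
  have := ler_wpM2l h2 h.
  have -> : 2 * x * y * x ^+ 3 = x ^+ 2 ^+ 2 * (2 * y) by ring.
  by have -> : 2 * x * y * y ^+ 3 = y ^+ 2 ^+ 2 * (2 * x) by ring.
case: alpha al0 => [r||]// r0; last by rewrite mulrC.
have -> : j%:R ^+ 2 * (r * k%:R) = r * j%:R * k%:R * j%:R by ring.
have -> : k%:R ^+ 2 * (r * j%:R) = r * j%:R * k%:R * k%:R by ring.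
by rewrite ler_wpM2l ?ler_nat// !mulr_ge0.
Qed.

Lemma log_bound_ge_rate alpha (b : R) : (0 <= alpha)%E -> (b%:E < alpha)%E ->
  exists K0, forall k, (K0 <= k)%N -> b * k%:R <= log_bound alpha k.
Proof.
case: alpha => [r||]// r0 hb; rewrite /log_bound.
  exists 0%N => k _; rewrite ler_wpDl ?mulr_ge0 ?sqrtr_ge0//.
  by rewrite ler_wpM2r// -lee_fin ltW.
have [K0 hK0] := archi_nat R b; exists K0 => k /hK0 h.
by rewrite ler_wpDl ?mulr_ge0 ?sqrtr_ge0// expr2 ler_wpM2r.
Qed.

Lemma log_bound_le_rate alpha (b : R) : (0 <= alpha)%E -> (alpha < b%:E)%E ->
  exists K0, forall k, (K0 <= k)%N -> log_bound alpha k <= b * k%:R.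
Proof.
case: alpha => [r||]// r0; rewrite lte_fin /log_bound => rb.
have br : 0 < b - r by rewrite subr_gt0.
have [K0 hK0] := archi_nat R ((2 / (b - r)) ^+ 2); exists K0 => k /hK0 h.
have s2 : Num.sqrt k%:R ^+ 2 = k%:R :> R by rewrite sqr_sqrtr.
have : 2 / (b - r) <= Num.sqrt k%:R.
  have -> : 2 / (b - r) = Num.sqrt ((2 / (b - r)) ^+ 2).
    by rewrite sqrtr_sqr ger0_norm// divr_ge0// ltW.
  by rewrite ler_wsqrtr.
rewrite ler_pdivrMr// => h2.
have := ler_wpM2r (sqrtr_ge0 k%:R) h2.
have -> : Num.sqrt k%:R * (b - r) * Num.sqrt k%:R = (b - r) * Num.sqrt k%:R ^+ 2 :> R by ring.
rewrite s2; lra.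
Qed.

Definition digit_bound alpha k : nat := Num.truncn (expR (log_bound alpha k)).

Lemma digit_bound_itv alpha k :
  (digit_bound alpha k)%:R <= expR (log_bound alpha k) < (digit_bound alpha k).+1%:R.
Proof. by apply: truncn_itv; exact: expR_ge0. Qed.

Lemma exp_log_bound_gap alpha k : (0 <= alpha)%E ->
  expR (log_bound alpha k.+1) / (Num.sqrt k.+1%:R + 1) <=
  expR (log_bound alpha k.+1) - expR (log_bound alpha k).
Proof.
move=> al0; have := log_bound_step alpha k al0.
set u := Num.sqrt k.+1%:R; set X := expR _; set Y := expR _ => h.
have u0 : 0 < u by rewrite sqrtr_gt0 ltr0n.
have Y0 : 0 < Y by exact: expR_gt0.
have YX : Y * (1 + u^-1) <= X.
  have -> : X = Y * expR (log_bound alpha k.+1 - log_bound alpha k).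
    by rewrite /X /Y -expRD addrC subrK.
  by rewrite ler_pM2l// (le_trans (expR_ge1Dx _))// ler_expR.
have : Y * (u + 1) <= X * u.
  have -> : Y * (u + 1) = Y * (1 + u^-1) * u by field; rewrite gt_eqF.
  by rewrite ler_wpM2r// ltW.
by move=> h2; rewrite ler_pdivrMr ?addr_gt0//; lra.
Qed.

Lemma digit_bound_lt alpha k : (0 <= alpha)%E -> (digit_bound alpha k < digit_bound alpha k.+1)%N.
Proof.
move=> al0; have := exp_log_bound_gap alpha k al0.
have /andP[h1 _] := digit_bound_itv alpha k.
set u := Num.sqrt k.+1%:R => gap.
have u0 : 0 < u by rewrite sqrtr_gt0 ltr0n.
have : 1 <= expR (log_bound alpha k.+1) / (u + 1).
  rewrite ler_pdivlMr ?addr_gt0// mul1r; apply: le_trans (expR_ge1Dx _).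
  by have := log_bound_ge alpha k.+1 al0; rewrite -/u; lra.
move=> h2; rewrite {2}/digit_bound truncn_gt_nat.
by rewrite -natr1; lra.
Qed.

(** By [exp_log_bound_gap] the window loses only a factor [sqrt (k + 1) + 1] against its upper end,
    and [expR ((1 - s) v)] outgrows this because [v >= 2 sqrt (k + 1)]. *)
Lemma digit_bound_gap alpha (s : R) : (0 <= alpha)%E -> s < 1 -> 0 <= s ->
  exists K0, forall k, (K0 <= k)%N ->
    s * log_bound alpha k.+1 <=
    ln (digit_bound alpha k.+1 - digit_bound alpha k)%N%:R.
Proof.
move=> al0 s1 s0; pose h := 1 - s; have h0 : 0 < h by rewrite subr_gt0.
(* The threshold ensures [u h^2 >= 2], whence [expR (2 h u) >= (2 h u)^2 / 2 >= 4 u >= 2 (u +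
   1)]. *)
have [K0 hK0] := archi_nat R ((2 / h ^+ 2) ^+ 2).
exists K0 => k Kk; pose u : R := Num.sqrt k.+1%:R; pose v := log_bound alpha k.+1.
have u1 : 1 <= u by rewrite -sqrtr1 ler_wsqrtr// ler1n.
have h20 : 0 < h ^+ 2 by rewrite exprn_gt0.
have uh : 2 / h ^+ 2 <= u.
  have -> : 2 / h ^+ 2 = Num.sqrt ((2 / h ^+ 2) ^+ 2).
    by rewrite sqrtr_sqr ger0_norm// divr_ge0// ltW.
  by rewrite ler_wsqrtr// hK0// ltnW.
rewrite ler_pdivrMr// in uh.
have vu : 2 * u <= v by exact: log_bound_ge.
have e1 : 2 * (u + 1) <= expR (h * v).
  apply: (@le_trans _ _ (expR (2 * h * u))); last by rewrite ler_expR mulrAC mulrC ler_pM2l.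
  apply: le_trans (expR_ge1Dxn 1%N _); last by rewrite !mulr_ge0// ltW// (lt_le_trans _ u1).
  have -> : (2 * h * u) ^+ 2 / 2`!%:R = 2 * ((u * h ^+ 2) * u) by rewrite !factS fact0; field.
  have : 2 * u <= u * h ^+ 2 * u by rewrite ler_wpM2r// (le_trans _ u1).
  lra.
have e2 : 1 <= expR (s * v).
  by rewrite -expR0 ler_expR mulr_ge0// (le_trans _ vu)// mulr_ge0// (le_trans _ u1).
(* The additional 1 pays for the truncation in [digit_bound]. *)
have e3 : expR (s * v) + 1 <= expR v / (u + 1).
  rewrite ler_pdivlMr; last by lra.
  have -> : expR v = expR (s * v) * expR (h * v) by rewrite -expRD; congr expR; rewrite /h; ring.
  have : expR (s * v) * (2 * (u + 1)) <= expR (s * v) * expR (h * v).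
    by rewrite ler_pM2l// expR_gt0.
  have : 1 * (u + 1) <= expR (s * v) * (u + 1) by rewrite ler_wpM2r//; lra.
  lra.
rewrite -[leLHS]expRK ler_ln ?posrE ?expR_gt0//; last first.
  by rewrite ltr0n subn_gt0 digit_bound_lt.
rewrite natrB ?(ltnW (digit_bound_lt _ _ al0))//.
have := exp_log_bound_gap alpha k al0; rewrite -/u -/v.
have /andP[h1 _] := digit_bound_itv alpha k.
have /andP[_ h2] := digit_bound_itv alpha k.+1; rewrite -natr1 -/v in h2.
lra.
Qed.

(** Sum [log_bound_ratio] over the indices; the 6 comes from the closed form
    [k (k + 1) (2 k + 1) / 6] of the sum of squares. A single bound is thus negligible against the
    sum of the earlier ones. *)
Lemma sum_log_bound alpha k : (0 <= alpha)%E ->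
  k%:R * log_bound alpha k.+1 <= 6 * \sum_(j < k) log_bound alpha j.+1.
Proof.
move=> al0.
have sq : (k * k.+1 ^ 2 <= 6 * \sum_(j < k) j.+1 ^ 2)%N.
  have -> : (6 * \sum_(j < k) j.+1 ^ 2 = k * k.+1 * (2 * k).+1)%N.
    elim: k => [|k IH]; first by rewrite big_ord0.
    by rewrite big_ord_recr mulnDr IH /= -mulnn; nia.
  by rewrite -mulnn mulnA leq_mul//; lia.
have b0 : 0 <= log_bound alpha k.+1.
  by apply: le_trans (log_bound_ge _ _ al0); rewrite mulr_ge0 ?sqrtr_ge0.
have k0 : 0 < k.+1%:R ^+ 2 :> R by rewrite exprn_gt0.
rewrite -(ler_pM2l k0) mulrCA mulrA.
have -> : k%:R * k.+1%:R ^+ 2 = (k * k.+1 ^ 2)%N%:R :> R by rewrite natrM natrX.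
apply: (@le_trans _ _ ((6 * \sum_(j < k) j.+1 ^ 2)%N%:R * log_bound alpha k.+1)).
  by rewrite ler_wpM2r// ler_nat.
rewrite natrM -mulrA [leRHS]mulrCA ler_pM2l// natr_sum mulr_suml mulr_sumr.
by apply: ler_sum => j _; rewrite natrX log_bound_ratio// ltnS ltnW.
Qed.

(** * Windows with a frozen prefix *)

Section PrefixedWindows.
Variables (alpha : \bar R) (c : nat -> nat) (p : nat).
Hypotheses (al0 : (0 <= alpha)%E) (cd : digit_seq c)
  (cp : forall i, (i < p)%N -> (c i <= digit_bound alpha p)%N).

(** Windows are open on the left, so below [p] they reduce to the single digit [c i]. *)
Definition window_lo i := if (i < p)%N then (c i).-1 else digit_bound alpha i.
Definition window_hi i := if (i < p)%N then c i else digit_bound alpha i.+1.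

Lemma prefixed_windows : digit_windows window_lo window_hi.
Proof.
move=> i; rewrite /window_lo /window_hi.
have [ip|pi] := ltnP i p.
  rewrite prednK ?digit_seq_gt0// leqnn /=; case: ltnP => ip'.
    by have := cd.2 i; lia.
  by have -> : i.+1 = p; [lia | exact: cp].
by rewrite digit_bound_lt//= ltnNge (leqW pi)/=.
Qed.

(** In logarithms, late windows have size at least [(s + h) log_bound]. This beats [s] times the
    logarithm of the upper end and leaves [h] times the sum of the bounds to absorb the factor
    [B k ^ 3]. *)
Lemma prefixed_windows_growth : window_growth R window_lo window_hi.
Proof.
move=> s /andP[s0 s1]; pose h := (1 - s) / 2; have h0 : 0 < h by rewrite divr_gt0// subr_gt0.
have [||J hJ] := digit_bound_gap alpha (s + h) al0; [rewrite /h; lra | lra |].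
have w := prefixed_windows.
have Bp i : (0 < window_hi i)%N by have /andP[H _] := w i; apply: leq_ltn_trans H.
have np i : (0 < window_hi i - window_lo i)%N by have /andP[H _] := w i; rewrite subn_gt0.
have lnB i : (p <= i)%N -> 0 <= (ln (window_hi i)%:R : R) <= log_bound alpha i.+1.
  move=> pi; rewrite ln_ge0 ?ler1n//= -[leRHS]expRK ler_ln ?posrE ?ltr0n ?expR_gt0//.
  by rewrite /window_hi ltnNge pi /=; have /andP[] := digit_bound_itv alpha i.+1.
pose f j : R := ln (window_hi j - window_lo j)%N%:R - s * ln (window_hi j)%:R
  - h * log_bound alpha j.+1.
have [j|c1 hc1] := sum_bounded_below f (maxn J p).
  rewrite geq_max => /andP[Jj pj]; rewrite /f.
  have /andP[l0 l1] := lnB j pj; have := hJ j Jj; have := ler_wpM2l s0 l1.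
  by rewrite /window_hi /window_lo ltnNge pj /= mulrDl; lra.
pose F k : R := \sum_(j < k) ln (window_hi j - window_lo j)%N%:R
  - s * (\sum_(j < k) ln (window_hi j)%:R + 3 * ln (window_hi k)%:R).
(* Here 18 is 3, the exponent of [window_hi k], times the 6 of [sum_log_bound]. *)
have [K1 hK1] := archi_nat R (18 / h).
have [k|c2 hc2] := bounded_below_from F (maxn K1 p) c1.
  rewrite geq_max => /andP[Kk pk]; have := hc1 k; rewrite /f !sumrB -!mulr_sumr /F.
  have /andP[l0 l1] := lnB k pk; have := sum_log_bound alpha k al0.
  have := hK1 k Kk; rewrite ler_pdivrMr// => hk.
  set S := \sum_(j < k) log_bound _ _; set S1 := \sum_(j < k) ln _; set S2 := \sum_(j < k) ln _.
  set v := log_bound _ _ in l1 *; set l := ln _ in l0 l1 *.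
  move=> q1 q2.
  have q3 : 18 * v <= k%:R * h * v by rewrite ler_wpM2r// (le_trans l0).
  have q4 := ler_wpM2l (ltW h0) q1.
  have q5 : s * l <= 1 * l by rewrite ler_wpM2r// ltW.
  have e1 : h * (k%:R * v) = k%:R * h * v by ring.
  have e2 : s * (S2 + 3 * l) = s * S2 + 3 * (s * l) by ring.
  by rewrite e1 in q4; rewrite e2; lra.
exists (expR (- c2)); first exact: expR_gt0.
move=> k; have := hc2 k; rewrite /F -(ln_prodn R window_hi)//.
rewrite -(ln_prodn R (fun i => window_hi i - window_lo i)%N)//.
set P := (\prod_(i < k) window_hi i)%N; set Q := (\prod_(i < k) _)%N.
have P0 : 0 < P%:R :> R by rewrite ltr0n prodn_gt0.
have Q0 : 0 < Q%:R :> R by rewrite ltr0n prodn_gt0.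
have B0 : 0 < (window_hi k)%:R :> R by rewrite ltr0n.
move=> hk; rewrite natrM natrX -[leRHS]lnK ?posrE ?mulr_gt0 ?expR_gt0//.
rewrite -[leLHS]lnK ?posrE ?powR_gt0 ?mulr_gt0 ?exprn_gt0// ler_expR ln_powR.
have -> : ln (P%:R * (window_hi k)%:R ^+ 3) = ln P%:R + 3 * ln (window_hi k)%:R :> R.
  by rewrite lnM ?posrE ?exprn_gt0// lnXn// mulr_natl.
by rewrite lnM ?posrE ?expR_gt0// expRK; lra.
Qed.

Lemma prefixed_windows_rate d : in_windows window_lo window_hi d ->
  log_digits_rate R d alpha.
Proof.
move=> dw; have dd := in_windows_digit_seq _ _ d prefixed_windows dw.
have lnd i : (p <= i)%N -> log_bound alpha i <= (ln (d i)%:R : R) <= log_bound alpha i.+1.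
  move=> pi; have := dw i; rewrite /window_lo /window_hi [(i < p)%N]ltnNge pi /= => /andP[h1 h2].
  have d0 := digit_seqR_gt0 R d i dd.
  have /andP[_ h3] := digit_bound_itv alpha i; have /andP[h4 _] := digit_bound_itv alpha i.+1.
  rewrite -[X in X <= _ <= _]expRK -[X in _ <= _ <= X]expRK !ler_ln ?posrE ?expR_gt0//.
  by rewrite (le_trans (ltW h3)) ?ler_nat// (le_trans _ h4)// ler_nat.
split=> b.
  move=> b0 /lte_dense_real[b' /andP[bb' b'a]].
  have [J hJ] := log_bound_ge_rate alpha b' al0 b'a.
  rewrite lte_fin in bb'.
  apply: (sum_ge_quadratic (fun i => ln (d i)%:R) b b' (maxn J p) bb') => j.
  rewrite geq_max => /andP[/hJ h1 /lnd/andP[h2 _]]; exact: le_trans h1 h2.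
move=> /lte_dense_real[b' /andP[ab' b'b]].
(* A second intermediate rate absorbs the shift of index in the upper end of the window:
   [b2 (j + 1) <= b' j] for large [j]. *)
have [b2 /andP[ab2 b2b']] := lte_dense_real R _ _ ab'.
have [J hJ] := log_bound_le_rate alpha b2 al0 ab2.
rewrite !lte_fin in b2b' b'b.
have [J2 hJ2] := archi_nat R (b2 / (b' - b2)).
apply: (sum_le_quadratic (fun i => ln (d i)%:R) b b' (maxn J (maxn p J2)) b'b) => j.
rewrite !geq_max => /and3P[Jj pj J2j].
have /andP[_ h1] := lnd j pj; apply: le_trans h1 _; apply: le_trans (hJ j.+1 (leqW Jj)) _.
have := hJ2 j J2j; rewrite ler_pdivrMr ?subr_gt0// -natr1; lra.
Qed.

End PrefixedWindows.

End Growth.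

(** * A parametrized family of solutions inside an open set *)

Section Assembly.
Variable R : realType.
Local Open Scope ring_scope.

(* Take n Pierce digits of x, then consecutive integers. *)
Lemma pierce_approx n m (x : R) : 0 <= x <= m.+1%:R^-1 ->
  exists c K, [/\ digit_seq c, (m < c 0%N)%N, forall i, (c i <= K + i)%N &
    forall t, pierce_tails R c t -> `|x - t 0%N| <= (m + n).+1%:R^-1].
Proof.
have tail_only k (z : R) : 0 <= z <= k.+1%:R^-1 ->
    exists c K, [/\ digit_seq c, (k < c 0%N)%N, forall i, (c i <= K + i)%N &
    forall t, pierce_tails R c t -> `|z - t 0%N| <= k.+1%:R^-1].
  move=> z01; exists (fun i => k.+1 + i)%N, k.+1; split; [| by rewrite addn0 | by [] |].
    by split=> [|i]; rewrite ?addn0 ?addnS.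
  move=> t ct; have [/andP[h0 h1] _] := ct 0%N; rewrite addn0 in h1.
  move: z01 h1; set r := k.+1%:R^-1 => /andP[z0 z1] h1; rewrite ler_norml; apply/andP; split; lra.
elim: n m x => [|n IH] m x x01; first by rewrite addn0; exact: tail_only.
have [x0|xn0] := eqVneq x 0.
  have [|c [K [h1 h2 h3 h4]]] := tail_only (m + n.+1)%N 0.
    by rewrite lexx invr_ge0 ler0n.
  exists c, K; split => //; first by apply: leq_ltn_trans h2; rewrite leq_addr.
  by rewrite x0; exact: h4.
have /andP[x0 x1] := x01; have xp : 0 < x by rewrite lt_neqAle eq_sym xn0.
pose d := Num.truncn x^-1.
have /andP[d0 d1] : d%:R <= x^-1 < d.+1%:R by apply: truncn_itv; rewrite invr_ge0.
have dm : (m < d)%N by rewrite /d truncn_gt_nat -(invrK m.+1%:R) lef_pV2 ?posrE ?invr_gt0.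
have dp : 0 < d%:R :> R by rewrite ltr0n; apply: leq_trans dm.
(* The image of [x] under the Pierce map is at most [1 / (d + 1)], so [d] takes over the role of
   [m]; as [d > m], the accuracy does not degrade. *)
have [|c [K [h1 h2 h3 h4]]] := IH d (1 - d%:R * x).
  rewrite subr_ge0 -ler_pdivlMr// mul1r d0 /=.
  have hx : d.+1%:R^-1 < x by rewrite invf_plt ?posrE.
  rewrite lerBlDr -[leRHS]addrC -lerBlDr.
  have -> : 1 - d.+1%:R^-1 = d%:R * d.+1%:R^-1 :> R.
    by rewrite -natr1; field; rewrite natr1 pnatr_eq0.
  by rewrite ler_pM2l// ltW.
exists (fun i => if i is j.+1 then c j else d), (K + d)%N; split => //.
- split=> [|[|i]] /=; [by apply: leq_trans dm | exact: h2 | exact: h1.2].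
- by case=> [|i] /=; [rewrite addn0 leq_addl | have := h3 i; lia].
move=> t ct; have ct' : pierce_tails R c (fun i => t i.+1) by move=> i; exact: (ct i.+1).
have := h4 _ ct'; have [_ e0] := ct 0%N; rewrite /= in e0 => h5.
have -> : x - t 0%N = - ((1 - d%:R * x - t 1%N) / d%:R).
  have -> : t 0%N = (1 - t 1%N) / d%:R by rewrite -e0 mulfK// gt_eqF.
  by field; rewrite gt_eqF.
rewrite normrN normrM normfV normr_nat.
apply: (@le_trans _ _ `|1 - d%:R * x - t 1%N|).
  by rewrite ler_piMr// invf_le1// ler1n; apply: leq_trans dm.
by apply: le_trans h5 _; rewrite lef_pV2 ?posrE ?ltr0Sn// ler_nat; lia.
Qed.

Lemma digit_bound_superlinear alpha K : (0 <= alpha)%E ->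
  exists P, forall p, (P <= p)%N -> (K + p <= digit_bound R alpha p)%N.
Proof.
move=> al0; exists (K + 3)%N => p hp.
have /andP[_ h] := digit_bound_itv R alpha p.
have hb := log_bound_ge R alpha p al0.
have s0 : 0 <= 2 * Num.sqrt p%:R :> R by rewrite mulr_ge0// sqrtr_ge0.
have h1 := expR_ge1Dxn 3%N s0.
have e : (2 * Num.sqrt p%:R) ^+ 4 / 4`!%:R = (2 / 3) * p%:R ^+ 2 :> R.
  rewrite -[X in _ * X ^+ 2](@sqr_sqrtr R p%:R)// !factS fact0.
  by field.
rewrite -ltnS -(ltr_nat R); apply: le_lt_trans h; rewrite -ler_expR in hb.
apply: le_trans hb; apply: le_trans h1; rewrite e natrD.
have h3 : K%:R + 3 <= p%:R :> R by rewrite -natrD ler_nat.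
have : 0 <= K%:R :> R by [].
nra.
Qed.

Lemma leap_set_param alpha (U : set (unit_interval R)) : (0 <= alpha)%E ->
  open U -> U !=set0 ->
  exists g : R -> R,
    (forall y, 0 <= y < 1 -> [set val x | x in U `&` leap_set alpha] (g y)) /\
    (forall s, 0 <= s < 1 -> exists2 C, 0 < C & forall y y', 0 <= y < 1 -> 0 <= y' < 1 ->
      `|y - y'| <= C * `|g y - g y'| `^ s).
Proof.
move=> al0 [V oV VU] [x0 Ux0].
have Vx0 : V (val x0) by rewrite -VU in Ux0.
have [e /= e0 eV] : nbhs_ball (val x0) V by rewrite nbhs_ballE; exact: open_nbhs_nbhs.
have x01 : 0 <= val x0 <= 1.
  by have := set_valP x0; rewrite /unit_interval /= in_itv.
have [n hn] := archi_nat R (2 / e).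
have [|c [K [cd _ cK capp]]] := pierce_approx n 0 (val x0).
  by rewrite invr1.
have [P hP] := digit_bound_superlinear alpha K al0.
(* The radius [e] is shared out: [e / 2] for replacing the point by one with digits [c], and [e / 4]
   for changing the digits from position [p] on. *)
have [Q hQ] := archi_nat R (4 / e).
pose p := (maxn P (maxn Q 1)).
have [pP pQ p1] : [/\ (P <= p)%N, (Q <= p)%N & (1 <= p)%N].
  by rewrite /p !leq_max !leqnn ?orbT.
have cp i : (i < p)%N -> (c i <= digit_bound R alpha p)%N.
  by move=> ip; apply: leq_trans (hP p pP); apply: leq_trans (cK i) _; rewrite leq_add2l ltnW.
pose lo := window_lo R alpha c p; pose hi := window_hi R alpha c p.
have w : digit_windows lo hi by exact: prefixed_windows.
have gr : window_growth R lo hi by exact: prefixed_windows_growth.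
have /choice[T hT] y : exists t, 0 <= y < 1 -> pierce_tails R (window_digits R lo hi y) t.
  have [y01|no] := boolP (0 <= y < 1); last by exists (fun=> 0).
  have dd := in_windows_digit_seq _ _ _ w (window_digits_in R lo hi y w y01).
  by have [t ht] := exists_pierce_tails R _ dd; exists t.
exists (fun y => T y 0%N); split; last exact: (window_param_holder R lo hi T w gr hT).
move=> y y01; have dw := window_digits_in R lo hi y w y01; have ht := hT y y01.
have dd := in_windows_digit_seq _ _ _ w dw.
have T01 : T y 0%N \in unit_interval R.
  by rewrite inE /unit_interval /= in_itv /=; exact: (pierce_tails_le1 R _ _ 0%N dd ht).
pose x : unit_interval R := SigSub T01.
exists x => //; split; last first.
  exact: (leap_set_rate R _ _ alpha x dd ht al0 (prefixed_windows_rate R alpha c p al0 cd cp _ dw)).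
rewrite -VU; apply: eV; rewrite /ball /=.
have [t ct] := exists_pierce_tails R c cd.
have h1 := capp t ct.
have agree i : (i < p)%N -> c i = window_digits R lo hi y i.
  move=> ip; have := dw i; rewrite /lo /hi /window_lo /window_hi ip.
  by have := digit_seq_gt0 c i cd; lia.
have h2 := pierce_prefix_sub R c _ t _ p cd dd ct ht agree.
have /andP[a0 a1] := pierce_tails_le1 R c t p cd ct.
have /andP[b0 b1] := pierce_tails_le1 R _ _ p dd ht.
have h3 : `|t 0%N - T y 0%N| <= p%:R^-1.
  rewrite h2; apply: (@le_trans _ _ ((digit_prod c p)%:R^-1)).
    by rewrite ler_piMl// ler_norml; apply/andP; split; lra.
  by rewrite lef_pV2 ?posrE ?ltr0n ?digit_prod_gt0// ler_nat digit_prod_ge.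
have h4 : p%:R^-1 <= e / 4.
  by rewrite -invf_div lef_pV2 ?posrE ?divr_gt0 ?ltr0n// hQ.
have h5 : (0 + n).+1%:R^-1 <= e / 2.
  by rewrite -invf_div lef_pV2 ?posrE ?divr_gt0 ?ltr0n// hn// add0n.
have -> : val x0 - T y 0%N = (val x0 - t 0%N) + (t 0%N - T y 0%N) by rewrite addrA subrK.
apply: le_lt_trans (ler_normD _ _) _.
apply: le_lt_trans (lerD (le_trans h1 h5) (le_trans h3 h4)) _; lra.
Qed.

End Assembly.

Theorem theorem1p3 (R : realType) (alpha : \bar R) (halpha : 0 <= alpha) :
  dense (leap_set alpha) /\
  (forall U : set (unit_interval R), open U -> U !=set0 ->
     hausdorff_dim [set val x | x in U `&` leap_set alpha] = 1).
Proof.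
split=> [U U0 oU|U oU U0]; have [g [gE gC]] := leap_set_param R alpha U halpha oU U0.
  (* Density asks for a single point, taken at parameter 0. *)
  have [|x Ux _] := gE 0%R; last by exists x.
  by rewrite lexx ltr01.
apply/eqP; rewrite eq_le (hausdorff_dim_ge1 R _ g gE gC) andbT.
by apply: hausdorff_dim_le1 => _ [x _ <-]; exact: set_valP.
Qed.
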